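(* Let $A$ satisfy the assumptions (A1)--(A5) listed in the context, with $\eta=\sup_{j\in\mathbb Z}\sum_{n\ne j}|\lambda_n-\lambda_j|^{-2}$. Let $B\in\mathfrak S_2(H,\mathcal P_\Sigma)$ for some partition $\Sigma=\{\sigma_n:n\in\mathcal I\}$ of $\sigma(A)$, let $J_\Sigma B=0$, and let $\|B\|_\Sigma<\frac{1}{3\sqrt\eta}$. Put $$\Phi(X)=B\,\Gamma_\Sigma X-(\Gamma_\Sigma X)J_\Sigma(B\,\Gamma_\Sigma X)+B,\qquad X\in\mathfrak S_2(H,\mathcal P_\Sigma).$$ Let $X_*\in\mathfrak S_2(H,\mathcal P_\Sigma)$ be the limit of the simple iterations $X_0=0$, $X_1=\Phi(X_0)=B$, etc. (this limit exists), and let $U=\Gamma_\Sigma X_*$, $V=J_\Sigma X_*$. Then $V=J_\Sigma X_*=J_\Sigma(B\,\Gamma_\Sigma X_* )$ and: (1) $U,V\in\mathfrak S_2(H,\mathcal P_\Sigma)$, the operator $A-B$ is similar to the operator $A-V$, and the similarity transform is given by $I+U$: $$(A-B)(I+U)=(I+U)(A-V).$$ (2) The $\Sigma$-matrix of $V$ is diagonal, i.e. $P_{\sigma_m}VP_{\sigma_n}=0$ for $m\ne n$, and the spectral projections $P'_{\sigma_n'}=(I+U)P_{\sigma_n}(I+U)^{-1}$, $n\in\mathcal I$, of the operator $A-B$ form a resolution of the identity.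
   Context: $H$ is a separable complex Hilbert space and $B(H)$ the algebra of bounded linear operators on $H$. Resolution of the identity: a finite or countable family $\{E_n\}$ of idempotents in $B(H)$ such that each $E_n$ is an orthogonal projection, $E_mE_n=0$ for $m\neq n$, and for each $x\in H$ the series $\sum_nE_nx$ converges unconditionally to $x$. Assumptions on the densely defined operator $A:D(A)\subseteq H\to H$: (A1) $A$ is a closed normal linear operator, i.e. $D(A^* )=D(A)$ and $\|A^*x\|=\|Ax\|$ for $x\in D(A)$; (A2) $\sigma(A)=\bigcup_{n\in\mathbb Z}\{\lambda_n\}$, where each $\lambda_n$ is a semisimple eigenvalue of $A$ of finite multiplicity; (A3) the Riesz projections $P_n=P(\{\lambda_n\},A)$ (so $AP_n=\lambda_nP_n$) form a resolution of the identity; (A4) $\eta<\infty$; (A5) for every $\varepsilon>0$ there is $\lambda_\varepsilon\in\rho(A)$ with $\|(A-\lambda_\varepsilon I)^{-1}\|<\varepsilon$. For the partition $\Sigma$ (with $\mathcal I\subseteq\mathbb Z$), $P_{\sigma_n}=\sum_{\lambda_k\in\sigma_n}P_k$ and $\mathcal P_\Sigma=\{P_{\sigma_n}:n\in\mathcal I\}$. $\mathfrak S_2(H,\mathcal P_\Sigma)$ is the space of $X\in B(H)$ with $\|X\|_\Sigma^2=\sum_{m,n\in\mathcal I}\|P_{\sigma_m}XP_{\sigma_n}\|^2<\infty$ (operator norms). Transforms: $J_\Sigma X=\sum_{n\in\mathcal I}P_{\sigma_n}XP_{\sigma_n}$; $\Gamma X$ is the operator with $P_m(\Gamma X)P_n=\frac{P_mXP_n}{\lambda_m-\lambda_n}$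 for $m\ne n$ and $P_n(\Gamma X)P_n=0$ ($m,n\in\mathbb Z$); $\Gamma_\Sigma X=\Gamma(X-J_\Sigma X)$. Similarity: operators $A_1,A_2$ are similar, with similarity transform $W$ of $A_1$ into $A_2$, if $W\in B(H)$ is continuously invertible, $WD(A_2)=D(A_1)$ and $A_1Wx=WA_2x$ for $x\in D(A_2)$. The operators $A-B$ and $A-V$ have domain $D(A)$. $\sigma_n'$ is the component of $\sigma(A-B)$ corresponding to $\sigma_n$.
   Formalization: In (2) the projections (I+U)P_{σ_n}(I+U)^{-1} need not be orthogonal in H (e.g. λ_n=n, B=b e_0⊗e_1^* ), so they form a resolution of the identity with orthogonality taken in the equivalent inner product ⟨(I+U)^{-1}x,(I+U)^{-1}y⟩. *)

(* Defs.v *)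
From HB Require Import structures.
From mathcomp Require Import all_boot all_order all_algebra finmap.
From mathcomp Require Import sesquilinear complex.
From mathcomp Require Import all_classical all_reals all_analysis.

Set Implicit Arguments.
Unset Strict Implicit.
Unset Printing Implicit Defensive.

Import Order.TTheory GRing.Theory Num.Theory.
Import numFieldNormedType.Exports.

Local Open Scope classical_set_scope.
Local Open Scope ring_scope.

(* Norms over R[i] take their values in R[i]. *)
Definition rnorm (R : realType) (V : normedZmodType R[i]) (x : V) : R :=
  complex.Re `|x|.

(* With completeness of H, this makes (H, inner) a complex Hilbert space;
   inner is linear in its first argument and antilinear in the second. *)
Definition norm_of_inner (R : realType) (H : normedModType R[i])
    (inner : {dot H for Num.Def.conjC}) : Prop :=
  forall x, `|x| ^+ 2 = inner x x.

Definition separable (T : topologicalType) : Prop :=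
  exists2 S : set T, countable S & dense S.

Section Operators.
Variables (R : realType) (H : completeNormedModType R[i]).

(* B(H) is the set of the functions H -> H satisfying this predicate; sums,
   differences and 0 are those of the functions H -> H. *)
Definition bounded_op (X : H -> H) : Prop := linear X /\ continuous X.

(* Only meaningful for bounded operators. *)
Definition opnorm (X : H -> H) : R :=
  sup [set rnorm (X x) | x in [set x | rnorm x <= 1]].

(* The inverse in B(H), and 0 if there is none. *)
Definition opinv (W : H -> H) : H -> H :=
  xget 0 [set W' | [/\ bounded_op W', W \o W' = id & W' \o W = id]].

Definition invertible (W : H -> H) : Prop :=
  bounded_op W /\
  exists W', [/\ bounded_op W', W \o W' = id & W' \o W = id].

(* Convergence along the finite subsets of D, which is unconditional
   convergence of the series. *)
Definition uncond_sum (D : set int) (f : int -> H) (l : H) : Prop :=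
  forall e : R, 0 < e ->
    exists2 F0 : {fset int}, [set` F0] `<=` D &
      forall F : {fset int}, [set` F0] `<=` [set` F] -> [set` F] `<=` D ->
        rnorm (\sum_(n <- F) f n - l) < e.

(* The bounded operator sum_(n in D) X n, the series converging
   unconditionally in the strong operator topology. *)
Definition opsum (D : set int) (X : int -> H -> H) : H -> H :=
  xget 0 [set Y | bounded_op Y /\
                  forall x, uncond_sum D (fun n => X n x) (Y x)].

(* The values of an operator outside of its domain are irrelevant. *)
Record operator := Operator { dom : set H; app :> H -> H }.

Definition linear_operator (T : operator) : Prop :=
  dom T 0 /\ forall (a : R[i]) x y, dom T x -> dom T y ->
    dom T (a *: x + y) /\ T (a *: x + y) = a *: T x + T y.

Definition op_sub (T : operator) (X : H -> H) : operator :=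
  Operator (dom T) (fun x => T x - X x).

Definition closed_operator (T : operator) : Prop :=
  closed [set p : H * H | dom T p.1 /\ p.2 = T p.1].

Definition adjoint (inner : H -> H -> R[i]) (T : operator) : operator :=
  Operator
    [set y | exists z, forall x, dom T x -> inner (T x) y = inner x z]
    (fun y => xget 0
       [set z | forall x, dom T x -> inner (T x) y = inner x z]).

Definition normal (inner : H -> H -> R[i]) (T : operator) : Prop :=
  dom (adjoint inner T) = dom T /\
  forall x, dom T x -> `|adjoint inner T x| = `|T x|.

(* S inverts T - z on the subspace M, which T is meant to leave invariant.
   S is required to be bounded on the whole of H: on a closed subspace M this
   is no restriction, M being complemented. *)
Definition is_resolvent_on (T : operator) (M : set H) (z : R[i])
    (S : H -> H) : Prop :=
  [/\ bounded_op S,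
      forall y, M y -> [/\ M (S y), dom T (S y) & T (S y) - z *: S y = y] &
      forall x, M x -> dom T x -> S (T x - z *: x) = x].

(* The spectrum of the part of T in the subspace M. *)
Definition spectrum_on (T : operator) (M : set H) : set R[i] :=
  [set z | ~ exists S, is_resolvent_on T M z S].

Definition spectrum (T : operator) : set R[i] := spectrum_on T setT.

Definition resolvent_set (T : operator) : set R[i] := ~` spectrum T.

(* (T - z)^-1 *)
Definition resolvent (T : operator) (z : R[i]) : H -> H :=
  xget 0 [set S | is_resolvent_on T setT z S].

Definition cintegral (a b : R) (f : R -> R[i]) : R[i] :=
  Complex (\int[lebesgue_measure]_(t in `[a, b]) complex.Re (f t))
          (\int[lebesgue_measure]_(t in `[a, b]) complex.Im (f t)).

Definition cis (t : R) : R[i] := Complex (cos t) (sin t).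

(* The projection - (2 pi i)^-1 \oint (T - z)^-1 dz, the integral being taken
   over z = z0 + r e^(it), 0 <= t <= 2 pi, in the weak sense, for an isolated
   point z0 of the spectrum and any small enough r > 0. *)
Definition riesz_projection (inner : H -> H -> R[i]) (T : operator)
    (z0 : R[i]) : H -> H :=
  xget 0 [set P | bounded_op P /\
    \forall r \near (0 : R)^'+,
      [set z | 0 < rnorm (z - z0) <= r] `<=` resolvent_set T /\
      forall x y, inner (P x) y =
        - (Complex (2 * pi) 0)^-1 *
        cintegral 0 (2 * pi) (fun t =>
          Complex r 0 * cis t *
          inner (resolvent T (z0 + Complex r 0 * cis t) x) y)].

Definition eigenvalue (T : operator) (z : R[i]) : Prop :=
  exists x, [/\ x != 0, dom T x & T x = z *: x].

(* The resolvent has a simple pole at z, i.e. the range of the Riesz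
   projection consists of eigenvectors. *)
Definition semisimple_eigenvalue (inner : H -> H -> R[i]) (T : operator)
    (z : R[i]) : Prop :=
  [/\ eigenvalue T z,
      exists2 r : R, 0 < r &
        [set w | 0 < rnorm (w - z) < r] `<=` resolvent_set T &
      forall x, dom T (riesz_projection inner T z x) /\
        T (riesz_projection inner T z x) = z *: riesz_projection inner T z x].

Definition finite_rank (X : H -> H) : Prop :=
  exists (n : nat) (v : 'I_n -> H), forall x,
    exists c : 'I_n -> R[i], X x = \sum_i c i *: v i.

(* The orthogonality of the projections E n is relative to inner. *)
Definition resolution_of_identity (inner : H -> H -> R[i]) (D : set int)
    (E : int -> H -> H) : Prop :=
  [/\ forall n, D n -> bounded_op (E n) /\ E n \o E n = E n,
      forall n, D n -> forall x y, inner (E n x) y = inner x (E n y),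
      forall m n, D m -> D n -> m <> n -> E m \o E n = 0 &
      forall x, uncond_sum D (fun n => E n x) x].

(* The idempotent E reduces T to parts in its range and in its kernel with
   the spectra S and spectrum T minus S.  When S is bounded and isolated the
   Riesz projection of S is such an E; S is not assumed to be bounded here. *)
Definition spectral_projection (T : operator) (S : set R[i])
    (E : H -> H) : Prop :=
  [/\ bounded_op E /\ E \o E = E,
      forall x, dom T x -> dom T (E x) /\ T (E x) = E (T x),
      S `<=` spectrum T,
      spectrum_on T (range E) = S &
      spectrum_on T (E @^-1` [set 0]) = spectrum T `\` S].

(* W transforms T1 into T2. *)
Definition similarity (T1 T2 : operator) (W : H -> H) : Prop :=
  [/\ invertible W, W @` dom T2 = dom T1 &
      forall x, dom T2 x -> T1 (W x) = W (T2 x)].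

End Operators.

(* In \bar R the inverse of 0 is +oo, so eta_gap lam < +oo forces the lam n
   to be pairwise distinct. *)
Definition eta_gap (R : realType) (lam : int -> R[i]) : \bar R :=
  ereal_sup [set (\esum_(n in [set n | n != j])
                   ((rnorm (lam n - lam j) ^+ 2)%:E^-1))%E
            | j in [set: int]].

Section Transforms.
Variables (R : realType) (H : completeNormedModType R[i]).
Variables (P : int -> H -> H) (lam : int -> R[i]).
Variables (I : set int) (sigma : int -> set R[i]).

(* P_(sigma_n) *)
Definition block_proj (n : int) : H -> H :=
  opsum [set k | sigma n (lam k)] P.

(* X |-> \|X\|_Sigma, with value +oo when the double series diverges. *)
Definition S2norm (X : H -> H) : \bar R :=
  ((\esum_(p in I `*` I)
     ((opnorm (block_proj p.1 \o X \o block_proj p.2)) ^+ 2)%:E)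
   `^ 2^-1)%E.

Definition S2 (X : H -> H) : Prop := bounded_op X /\ (S2norm X < +oo)%E.

Definition S2_limit (X : nat -> H -> H) (Y : H -> H) : Prop :=
  [/\ forall k, S2 (X k), S2 Y &
      (fun k => S2norm (X k - Y)) @ \oo --> 0%E].

Definition JSigma (X : H -> H) : H -> H :=
  opsum I (fun n => block_proj n \o X \o block_proj n).

Definition Gamma (X : H -> H) : H -> H :=
  xget 0 [set Y | bounded_op Y /\ forall m n x,
    P m (Y (P n x)) =
      if m == n then 0 else (lam m - lam n)^-1 *: P m (X (P n x))].

Definition GammaSigma (X : H -> H) : H -> H := Gamma (X - JSigma X).

Definition Phi (B X : H -> H) : H -> H :=
  (B \o GammaSigma X) - (GammaSigma X \o JSigma (B \o GammaSigma X)) + B.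

End Transforms.

(* Main.v *)
Require Import Defs.
From HB Require Import structures.
From mathcomp Require Import all_boot all_order all_algebra finmap.
From mathcomp Require Import sesquilinear complex.
From mathcomp Require Import all_classical all_reals all_analysis.
From mathcomp Require Import ring lra.

Set Implicit Arguments.
Unset Strict Implicit.
Unset Printing Implicit Defensive.

Import Order.TTheory GRing.Theory Num.Theory.
Import numFieldNormedType.Exports.

Local Open Scope classical_set_scope.
Local Open Scope ring_scope.

(** The operator A is diagonal for the projections P n, so a commutator
    equation A U - U A = Z can be solved block by block: on the block (m, n) the
    left hand side is multiplication by lam m - lam n, hence U = Gamma Z solves
    the equation as soon as the blocks P n Z P n vanish. With Z = X - J X and
    U = Gamma Z, the identity (A - B) (I + U) = (I + U) (A - J X) reduces to
    X = B U - U (J X) + B, and taking J of this equation gives J X = J (B U),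
    because J U = 0 and J B = 0. So the whole task is to solve X = Phi X.

    Write gam for the square root of eta. A bounded X is sent by Gamma to an
    operator of norm at most gam |X|: the row P k (Gamma X) is P k X T k, where
    T k is the diagonal operator with the entries 1 / (lam k - lam j), and
    the sum over k of |T k x|^2 is at most eta |x|^2 (GammaP). Since Gamma
    commutes with the compression to a block, the same constant works for the
    norm |.|_Sigma (S2_le_Gamma). This norm dominates the operator norm, is
    submultiplicative (S2_leM) and complete (S2_complete), and J does not
    increase it. If beta is the norm of B, Phi therefore maps the ball of radius
    1/gam into the ball of radius 3 beta < 1/gam, and is a contraction of ratio
    3 beta gam < 1 on it. The iterates converge to a fixed point X with
    gam |X| <= 3 beta gam < 1, so that I + U is inverted by a Neumann series.

    Since A is closed and normal, x belongs to its domain, with A x = z, exactly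
    when P m z = lam m P m x for all m (normal_eigenrow, dom_coord). This makes
    the commutator equation rigorous and shows that I + U maps dom A into
    itself. It is onto dom A because, at a point where the resolvent of A is
    small, both A - B and A - V have a resolvent, and the two are conjugate by
    I + U (limit_similarity).

    Finally A - V is reduced by the block projections, and the same
    estimates give |V| <= beta < 1/(3 gam), while eigenvalues of different blocks
    are at least 1/gam apart. Each z is at distance at least 1/(2 gam) either
    from the eigenvalues in a block or from all the others, so A - V - z is
    invertible on the range or on the kernel of the block projection: the two
    parts have disjoint spectra, which is what makes the conjugated
    projections spectral projections of A - B. *)

(** * Real-valued norms and bounded operators *)

Section RealNorm.
Variable (R : realType).
Implicit Types (V : normedZmodType R[i]).

Lemma rnormE V (x : V) : `|x| = Complex (rnorm x) 0.
Proof.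
have := normr_ge0 x; rewrite /rnorm; case: (`|x|) => a b /=.
by rewrite lecE /= => /andP[/eqP-> _].
Qed.

Lemma rnorm_ge0 V (x : V) : 0 <= rnorm x.
Proof. by have := normr_ge0 x; rewrite rnormE lecE /= eqxx. Qed.

Lemma rnorm_ltP V (x : V) (e : R) : (rnorm x < e) = (`|x| < Complex e 0).
Proof. by rewrite rnormE ltcE /= eqxx. Qed.

Lemma rnorm0 V : rnorm (0 : V) = 0.
Proof. by rewrite /rnorm normr0. Qed.

Lemma rnorm_eq0 V (x : V) : (rnorm x == 0) = (x == 0).
Proof.
apply/eqP/eqP => [h|->]; last exact: rnorm0.
by apply/eqP; rewrite -normr_eq0 rnormE h eqE /= eqxx.
Qed.

Lemma rnorm_gt0 V (x : V) : (0 < rnorm x) = (x != 0).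
Proof. by rewrite lt_def rnorm_eq0 rnorm_ge0 andbT. Qed.

Lemma ler_rnormD V (x y : V) : rnorm (x + y) <= rnorm x + rnorm y.
Proof. by have := ler_normD x y; rewrite !rnormE lecE /= => /andP[]. Qed.

Lemma rnormN V (x : V) : rnorm (- x) = rnorm x.
Proof. by rewrite /rnorm normrN. Qed.

Lemma rnorm_distC V (x y : V) : rnorm (x - y) = rnorm (y - x).
Proof. by rewrite /rnorm distrC. Qed.

Lemma ler_rnormB V (x y : V) : rnorm (x - y) <= rnorm x + rnorm y.
Proof. by rewrite -(rnormN y) ler_rnormD. Qed.

Lemma ler_rnorm_dist V (x y : V) : rnorm x <= rnorm y + rnorm (x - y).
Proof. by rewrite -{1}(subrK y x) addrC ler_rnormD. Qed.

Lemma ler_rnorm_sum V (T : Type) (s : seq T) (f : T -> V) :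
  rnorm (\sum_(i <- s) f i) <= \sum_(i <- s) rnorm (f i).
Proof.
elim: s => [|a s IH]; first by rewrite !big_nil rnorm0.
by rewrite !big_cons (le_trans (ler_rnormD _ _)) // lerD2l.
Qed.

Lemma rnormZ (V : normedModType R[i]) (a : R[i]) (x : V) :
  rnorm (a *: x) = rnorm a * rnorm x.
Proof. by rewrite {1}/rnorm normrZ !rnormE /= mul0r subr0. Qed.

Lemma rnormM (a b : R[i]) : rnorm (a * b) = rnorm a * rnorm b.
Proof. by rewrite {1}/rnorm normrM !rnormE /= mul0r subr0. Qed.

Lemma rnormV (a : R[i]) : rnorm a^-1 = (rnorm a)^-1.
Proof.
have [->|a0] := eqVneq a 0; first by rewrite invr0 rnorm0 invr0.
have h : rnorm a != 0 by rewrite rnorm_eq0.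
apply: (mulfI h); rewrite -rnormM divff // divff //.
by rewrite /rnorm normr1.
Qed.

Lemma rnorm_real (a : R) : 0 <= a -> rnorm (Complex a 0 : R[i]) = a.
Proof.
move=> a0; rewrite /rnorm ger0_norm // lecE /= eqxx //.
Qed.

Lemma eq_rnorm_small V (x y : V) :
  (forall e : R, 0 < e -> rnorm (x - y) < e) -> x = y.
Proof.
move=> h; apply/eqP; rewrite -subr_eq0 -rnorm_eq0 eq_le rnorm_ge0 andbT leNgt.
by apply/negP => /h; rewrite ltxx.
Qed.

End RealNorm.

Section BoundedOps.
Variables (R : realType) (H : completeNormedModType R[i]).
Implicit Types X Y : H -> H.

Lemma lin0 X : linear X -> X 0 = 0.
Proof. by move=> lX; have := lX (-1) 0 0; rewrite scaler0 addr0 scaleN1r addNr. Qed.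

Lemma linD X x y : linear X -> X (x + y) = X x + X y.
Proof. by move=> lX; have := lX 1 x y; rewrite !scale1r. Qed.

Lemma linZ X a x : linear X -> X (a *: x) = a *: X x.
Proof. by move=> lX; have := lX a x 0; rewrite addr0 lin0 // addr0. Qed.

Lemma linN X x : linear X -> X (- x) = - X x.
Proof. by move=> lX; rewrite -scaleN1r linZ // scaleN1r. Qed.

Lemma linB X x y : linear X -> X (x - y) = X x - X y.
Proof. by move=> lX; rewrite linD // linN. Qed.

Lemma lin_sum X (T : Type) (s : seq T) (f : T -> H) : linear X ->
  X (\sum_(i <- s) f i) = \sum_(i <- s) X (f i).
Proof.
move=> lX; elim: s => [|a s IH]; first by rewrite !big_nil lin0.
by rewrite !big_cons linD // IH.
Qed.

Lemma lin_comp X Y : linear X -> linear Y -> linear (X \o Y).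
Proof. by move=> lX lY a x y /=; rewrite lY lX. Qed.

Lemma bounded_opP X : bounded_op X <->
  linear X /\ exists2 c : R, 0 <= c & forall x, rnorm (X x) <= c * rnorm x.
Proof.
split=> [[lX cX]|[lX [c c0 hc]]].
  split=> //.
  pose mX := GRing.isLinear.Build _ _ _ _ X lX.
  pose X' : {linear H -> H} := HB.pack X mX.
  have /linear_bounded_continuous/linear_boundedP : continuous X' by [].
  move=> /pinfty_ex_gt0[r r0 hr]; exists (complex.Re r).
    by move/ltW: r0; rewrite lecE => /andP[].
  move=> x; move: (r0) (hr x); rewrite ltcE /= => /andP[/eqP].
  case: r {hr r0} => a b /= -> a0.
  by rewrite !rnormE lecE /= => /andP[_]; rewrite mul0r subr0.
split=> //.
pose mX := GRing.isLinear.Build _ _ _ _ X lX.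
pose X' : {linear H -> H} := HB.pack X mX.
suff : continuous X' by [].
apply/linear_bounded_continuous/linear_boundedP.
near=> r => x; apply: (@le_trans _ _ (Complex c 0 * `|x|)); last first.
  rewrite ler_wpM2r //; near: r; apply: nbhs_pinfty_ge.
  by rewrite complex_real.
by rewrite !rnormE lecE /= !mulr0 !mul0r addr0 subr0 eqxx /=; exact: hc.
Unshelve. all: by end_near. Qed.

Lemma bounded_op_lin X : bounded_op X -> linear X.
Proof. by case. Qed.

Lemma bounded_opI X c : linear X -> 0 <= c ->
  (forall x, rnorm (X x) <= c * rnorm x) -> bounded_op X.
Proof. by move=> lX c0 hc; apply/bounded_opP; split=> //; exists c. Qed.

Lemma bounded_op0 : bounded_op (0 : H -> H).
Proof.
apply: (@bounded_opI _ 0) => // [a x y|x]; last by rewrite mul0r rnorm0.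
by rewrite /= scaler0 addr0.
Qed.

Lemma bounded_op_id : bounded_op (id : H -> H).
Proof. by apply: (@bounded_opI _ 1) => // x; rewrite mul1r. Qed.

Lemma bounded_op_comp X Y : bounded_op X -> bounded_op Y -> bounded_op (X \o Y).
Proof.
move=> /bounded_opP[lX [c c0 hc]] /bounded_opP[lY [d d0 hd]].
apply: (@bounded_opI _ (c * d)); rewrite ?mulr_ge0 //; first exact: lin_comp.
by move=> x /=; rewrite (le_trans (hc _)) // -mulrA ler_wpM2l.
Qed.

Lemma bounded_opD X Y : bounded_op X -> bounded_op Y -> bounded_op (X + Y).
Proof.
move=> /bounded_opP[lX [c c0 hc]] /bounded_opP[lY [d d0 hd]].
apply: (@bounded_opI _ (c + d)); rewrite ?addr_ge0 //.
  by move=> a x y; rewrite !fctE lX lY scalerDr addrACA.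
by move=> x; rewrite !fctE (le_trans (ler_rnormD _ _)) // mulrDl lerD.
Qed.

Lemma bounded_opZ a X : bounded_op X -> bounded_op (fun x => a *: X x).
Proof.
move=> /bounded_opP[lX [c c0 hc]].
apply: (@bounded_opI _ (rnorm a * c)); rewrite ?mulr_ge0 ?rnorm_ge0 //.
  by move=> b x y; rewrite lX scalerDr !scalerA mulrC.
by move=> x; rewrite rnormZ -mulrA ler_wpM2l ?rnorm_ge0.
Qed.

Lemma bounded_opN X : bounded_op X -> bounded_op (- X).
Proof.
move=> /(bounded_opZ (-1)); congr bounded_op.
by apply/funext => x; rewrite fctE scaleN1r.
Qed.

Lemma bounded_opB X Y : bounded_op X -> bounded_op Y -> bounded_op (X - Y).
Proof. by move=> bX bY; apply/bounded_opD/bounded_opN. Qed.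

(** The difference of two values of Phi, written as a sum of terms each of
    which is linear in an increment: UX - UY or JX - JY. *)
Lemma increment_formula (Y UX UY JX JY : H -> H) : linear Y -> linear UY ->
  ((Y \o UX) - (UX \o JX) + Y) - ((Y \o UY) - (UY \o JY) + Y) =
  (Y \o (UX - UY)) - (((UX - UY) \o JX) + (UY \o (JX - JY))).
Proof.
move=> lT lU; apply/funext => x; rewrite !fctE /= (linB _ _ lT) (linB _ _ lU).
rewrite subrKA opprD addrACA subrr addr0 !opprB.
by rewrite addrACA [RHS]addrACA; congr (_ + _); exact: addrC.
Qed.

(** The identity (A - B) (I + U) x = (I + U) (A - V) x once
    A U x = U A x + X x - V x and X = B U - U V + B are substituted, for
    a = A x, b = U (A x), c = B (U x), d = U (V x), e = B x and f = V x. *)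
Lemma intertwining_algebra (a b c d e f : H) :
  a + (b + (c - d + e - f)) - (e + c) = (a - f) + (b - d).
Proof.
have -> : c - d + e - f = (e + c) - (d + f).
  by rewrite -addrA addrACA -opprD (addrC c).
rewrite (addrCA b) (addrCA a) [LHS]addrC addKr opprD.
by rewrite -(addrA a) [- f + _]addrCA [- d - f]addrC.
Qed.

Section Opnorm.
Variables (X : H -> H).
Hypothesis bX : bounded_op X.

Let S := [set rnorm (X x) | x in [set x | rnorm x <= 1]].

Let S_sup : has_sup S.
Proof.
have /bounded_opP[lX [c c0 hc]] := bX; split.
  by exists (rnorm (X 0)); exists 0 => //=; rewrite rnorm0 ler01.
exists c => _ [x /= x1 <-]; apply: le_trans (hc x) _.
by rewrite -{2}(mulr1 c) ler_wpM2l.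
Qed.

Lemma opnorm_ge0 : 0 <= opnorm X.
Proof.
have : S (rnorm (X 0)) by exists 0 => //=; rewrite rnorm0 ler01.
move=> /(sup_upper_bound S_sup); apply: le_trans; exact: rnorm_ge0.
Qed.

Lemma opnormP x : rnorm (X x) <= opnorm X * rnorm x.
Proof.
have lX := bounded_op_lin bX.
have [->|x0] := eqVneq x 0; first by rewrite lin0 // rnorm0 mulr0.
have nx0 : 0 < rnorm x by rewrite rnorm_gt0.
rewrite -ler_pdivrMr //.
set a : R[i] := Complex (rnorm x)^-1 0.
have ha : rnorm a = (rnorm x)^-1 by rewrite rnorm_real // invr_ge0 ltW.
suff : S (rnorm (X x) / rnorm x) by exact: (sup_upper_bound S_sup).
exists (a *: x) => /=; first by rewrite rnormZ ha mulVf // gt_eqF.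
by rewrite linZ // rnormZ ha mulrC.
Qed.

Lemma opnorm_le c : 0 <= c -> (forall x, rnorm (X x) <= c * rnorm x) ->
  opnorm X <= c.
Proof.
move=> c0 hc; apply: ge_sup => [|_ [x /= x1 <-]]; first exact: S_sup.1.
by apply: le_trans (hc x) _; rewrite -{2}(mulr1 c) ler_wpM2l.
Qed.

(** The supremum defining the operator norm is approached but in general not
    attained; this replaces maximizing vectors. *)
Lemma opnorm_adherent t : t < opnorm X ->
  exists2 x, rnorm x <= 1 & t < rnorm (X x).
Proof.
by move=> tX; have /(_ t tX)[_ [x x1 <-]] := sup_gt S_sup.1; exists x.
Qed.

End Opnorm.

End BoundedOps.

(** * Completeness and unconditional convergence *)

Section Convergence.
Variables (R : realType) (H : completeNormedModType R[i]).

(** Completeness in terms of real radii, for an arbitrary proper filter: the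
    unconditional sums need it along the finite subsets of an index set. *)
Lemma complete_filter (F : set_system H) (FF : ProperFilter F) :
  (forall e : R, 0 < e -> exists x, F [set y | rnorm (x - y) < e]) ->
  exists l, forall e : R, 0 < e -> F [set y | rnorm (l - y) < e].
Proof.
move=> Fc; have : cauchy F.
  apply: cauchy_exP => eps eps0.
  have ep : 0 < complex.Re eps by move: eps0; rewrite ltcE => /andP[].
  have -> : eps = Complex (complex.Re eps) 0.
    by move: eps0; rewrite ltcE => /andP[/eqP + _]; case: (eps) => a b /= ->.
  have [x Fx] := Fc _ ep; exists x; apply: filterS Fx => y /=.
  by rewrite rnorm_ltP -ball_normE.
move=> /cauchy_cvg/cvg_ex[l Fl]; exists l => e e0.
suff : F (ball l (Complex e 0 : R[i])).
  by apply: filterS => y; rewrite -ball_normE /= rnorm_ltP.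
by apply: Fl; apply: nbhsx_ballx; rewrite ltcE /= eqxx.
Qed.

Lemma expr_small (q K e : R) : 0 <= q < 1 -> 0 < e -> 0 <= K ->
  exists N, forall n, (N <= n)%N -> K * q ^+ n < e.
Proof.
move=> /andP[q0 q1] e0 K0.
have qc : (fun n => q ^+ n) @ \oo --> (0 : R) by apply: cvg_expr; rewrite ger0_norm.
have K1 : 0 < K + 1 by rewrite ltr_wpDl.
have /cvgrPdist_lt/(_ (e / (K + 1)) (divr_gt0 e0 K1))[N _ hN] := qc.
exists N => n Nn; have /= := hN n Nn.
rewrite sub0r normrN ger0_norm ?exprn_ge0 // ltr_pdivlMr // => h.
apply: le_lt_trans h; rewrite mulrC ler_wpM2l ?exprn_ge0 //.
by rewrite lerDl.
Qed.

(** The rate is kept, since the convergence of operators in a stronger norm is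
    later deduced from it. *)
Lemma geometric_cvg (x : nat -> H) (C q : R) : 0 <= C -> 0 <= q < 1 ->
  (forall n, rnorm (x n.+1 - x n) <= C * q ^+ n) ->
  exists l, forall n, rnorm (x n - l) <= C / (1 - q) * q ^+ n.
Proof.
move=> C0 /andP[q0 q1] hx; set K := C / (1 - q).
have q1' : 0 < 1 - q by rewrite subr_gt0.
have K0 : 0 <= K by rewrite divr_ge0 // ltW.
have CE : C = K * (1 - q) by rewrite /K divfK // gt_eqF.
have step n k : rnorm (x (n + k)%N - x n) <= K * q ^+ n * (1 - q ^+ k).
  elim: k => [|k IH]; first by rewrite addn0 subrr rnorm0 expr0 subrr mulr0.
  rewrite -(subrKA (x (n + k)%N)) addnS.
  apply: le_trans (ler_rnormD _ _) _.
  apply: le_trans (lerD (hx _) IH) _.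
  rewrite CE exprD exprS le_eqVlt; apply/orP; left; apply/eqP; ring.
have step' n k : (n <= k)%N -> rnorm (x n - x k) <= K * q ^+ n.
  move=> /subnKC <-; rewrite rnorm_distC; apply: le_trans (step _ _) _.
  rewrite -{2}(mulr1 (K * q ^+ n)) ler_wpM2l //.
    by apply: mulr_ge0 => //; exact: exprn_ge0.
  by rewrite lerBlDr lerDl exprn_ge0.
have [e e0|l hl] := @complete_filter (x @ \oo) _.
  have [N hN] := expr_small (introT andP (conj q0 q1)) e0 K0.
  exists (x N); exists N => // n /= Nn.
  by apply: le_lt_trans (hN N (leqnn _)); exact: step'.
exists l => n; rewrite leNgt; apply/negP => h.
have e0 : 0 < rnorm (x n - l) - K * q ^+ n by rewrite subr_gt0.
have [N _ hN] := hl _ e0.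
have /= h1 := hN (maxn n N) (leq_maxr _ _).
have h2 := step' n (maxn n N) (leq_maxl _ _).
have : rnorm (x n - l) < rnorm (x n - l).
  rewrite -{1}(subrKA (x (maxn n N))).
  apply: le_lt_trans (ler_rnormD _ _) _; rewrite (rnorm_distC _ l).
  by apply: le_lt_trans (lerD h2 (lexx _)) _; rewrite -ltrBrDl.
by rewrite ltxx.
Qed.

Implicit Types (D : set int) (f g : int -> H).

Lemma uncond_sum_le D f l (c : R) : uncond_sum D f l ->
  (forall F : {fset int}, [set` F] `<=` D -> rnorm (\sum_(n <- F) f n) <= c) ->
  rnorm l <= c.
Proof.
move=> fl hc; apply/ler_addgt0Pr => e e0; have [F0 F0D hF] := fl e e0.
have := hF F0 (@subset_refl _ _) F0D; rewrite rnorm_distC => h.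
apply: le_trans (ler_rnorm_dist _ _) _; apply: lerD (hc _ F0D) _; exact: ltW h.
Qed.

Lemma uncond_sum_unique D f l l' : uncond_sum D f l -> uncond_sum D f l' -> l = l'.
Proof.
move=> fl fl'; apply: eq_rnorm_small => e e0.
have e20 : 0 < e / 2 by rewrite divr_gt0.
have [F0 F0D h0] := fl _ e20; have [F1 F1D h1] := fl' _ e20.
pose F := (F0 `|` F1)%fset.
have FD : [set` F] `<=` D by move=> n /=; rewrite inE => /orP[/F0D|/F1D].
have F0F : [set` F0] `<=` [set` F] by move=> n /= nF; rewrite inE nF.
have F1F : [set` F1] `<=` [set` F] by move=> n /= nF; rewrite inE nF orbT.
rewrite -(subrKA (\sum_(n <- F) f n)).
apply: le_lt_trans (ler_rnormD _ _) _; rewrite rnorm_distC (splitr e).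
by apply: ltrD; [exact: h0|exact: h1].
Qed.

Lemma uncond_sum_ext D f g l : (forall n, D n -> f n = g n) ->
  uncond_sum D f l -> uncond_sum D g l.
Proof.
move=> fg fl e /fl[F0 F0D h]; exists F0 => // F F0F FD.
suff -> : \sum_(n <- F) g n = \sum_(n <- F) f n by exact: h.
by apply: eq_big_seq => n /FD/fg.
Qed.

Lemma uncond_sum_lin D f l (T : H -> H) : bounded_op T ->
  uncond_sum D f l -> uncond_sum D (fun n => T (f n)) (T l).
Proof.
move=> bT fl e e0; have /bounded_opP[lT [c c0 hc]] := bT.
have c1 : 0 < c + 1 by rewrite ltr_wpDl.
have [F0 F0D h] := fl _ (divr_gt0 e0 c1); exists F0 => // F F0F FD.
rewrite -lin_sum // -linB //; apply: le_lt_trans (hc _) _.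
apply: (@le_lt_trans _ _ ((c + 1) * rnorm (\sum_(n <- F) f n - l))).
  by rewrite ler_wpM2r ?rnorm_ge0 // lerDl.
by rewrite mulrC -ltr_pdivlMr // h.
Qed.

Lemma uncond_sumD D f g l l' : uncond_sum D f l -> uncond_sum D g l' ->
  uncond_sum D (fun n => f n + g n) (l + l').
Proof.
move=> fl fl' e e0.
have e20 : 0 < e / 2 by rewrite divr_gt0.
have [F0 F0D h0] := fl _ e20; have [F1 F1D h1] := fl' _ e20.
exists (F0 `|` F1)%fset => [n /=|F FF FD].
  by rewrite inE => /orP[/F0D|/F1D].
rewrite big_split opprD addrACA; apply: le_lt_trans (ler_rnormD _ _) _.
rewrite (splitr e); apply: ltrD.
  by apply: h0 => // n /= nF; apply: FF; rewrite /= inE nF.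
by apply: h1 => // n /= nF; apply: FF; rewrite /= inE nF orbT.
Qed.

Lemma uncond_sum1 D k f : D k -> (forall n, D n -> n <> k -> f n = 0) ->
  uncond_sum D f (f k).
Proof.
move=> Dk h e e0; exists [fset k]%fset => [n /=|F kF FD].
  by rewrite inE => /eqP ->.
rewrite (big_fsetD1 k) /=; last by apply: kF; rewrite /= inE.
rewrite big_seq big1 => [|n]; first by rewrite addr0 subrr rnorm0.
by rewrite !inE => /andP[/eqP nk nF]; apply: h => //; exact: FD.
Qed.

Lemma uncond_sum0 D f : (forall n, D n -> f n = 0) -> uncond_sum D f 0.
Proof.
move=> h e e0; exists fset0 => [n /=|F _ FD]; first by rewrite inE.
by rewrite big_seq big1 ?subr0 ?rnorm0 // => n /FD/h.
Qed.

(** Serves to estimate a square sum of limits through the partial sums over a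
    single finite set. *)
Lemma uncond_sum_common (T : eqType) (s : seq T) (D : set int)
    (f : T -> int -> H) (l : T -> H) (e : R) : 0 < e ->
  {in s, forall i, uncond_sum D (f i) (l i)} ->
  exists F0 : {fset int}, [set` F0] `<=` D /\
  forall F : {fset int}, [set` F0] `<=` [set` F] -> [set` F] `<=` D ->
  {in s, forall i, rnorm (\sum_(n <- F) f i n - l i) < e}.
Proof.
move=> e0; elim: s => [|i s IH] h.
  by exists fset0; split=> // n; rewrite /= inE.
have [j sj|F0 [F0D h0]] := IH; first by apply: h; rewrite inE sj orbT.
have [F1 F1D h1] := h i (mem_head _ _) _ e0.
exists (F0 `|` F1)%fset; split=> [n /=|F F01 FD j].
  by rewrite inE => /orP[/F0D|/F1D].
have F0F : [set` F0] `<=` [set` F] by move=> n /= nF; apply: F01; rewrite /= inE nF.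
have F1F : [set` F1] `<=` [set` F].
  by move=> n /= nF; apply: F01; rewrite /= inE nF orbT.
by rewrite inE => /orP[/eqP->|sj]; [exact: h1|exact: h0].
Qed.

End Convergence.

(** * Orthogonal series in a Hilbert space *)

Section Orthogonal.
Variables (R : realType) (H : completeNormedModType R[i]).
Variable (inner : {dot H for Num.Def.conjC}).
Hypothesis nin : norm_of_inner inner.

Lemma inner_norm x : inner x x = Complex (rnorm x ^+ 2) 0.
Proof.
by rewrite -nin rnormE !expr2; congr Complex; rewrite ?mulr0 ?mul0r ?subr0 ?addr0.
Qed.

Lemma inner_conj x y : inner x y = (inner y x)^*.
Proof. by have := hermC inner x y; rewrite expr0 mul1r. Qed.

Lemma inner_eq0C x y : inner x y = 0 -> inner y x = 0.
Proof. by rewrite inner_conj => /(congr1 Num.Def.conjC); rewrite conjCK conjC0. Qed.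

Lemma inner_sum x (T : eqType) (s : seq T) (f : T -> H) :
  {in s, forall i, inner x (f i) = 0} -> inner x (\sum_(i <- s) f i) = 0.
Proof.
elim: s => [|a s IH] h; first by rewrite big_nil linear0r.
rewrite big_cons linearDr /= h ?mem_head // add0r IH // => i si.
by apply: h; rewrite inE si orbT.
Qed.

Lemma inner_inj x y : (forall z, inner x z = inner y z) -> x = y.
Proof.
move=> h; apply/eqP; rewrite -subr_eq0 -rnorm_eq0 -(sqrf_eq0 (rnorm _)).
have : inner (x - y) (x - y) = 0 by rewrite linearBl /= h subrr.
by rewrite inner_norm => -[->].
Qed.

Lemma pythagoras x y : inner x y = 0 ->
  rnorm (x + y) ^+ 2 = rnorm x ^+ 2 + rnorm y ^+ 2.
Proof.
move=> xy; have yx := inner_eq0C xy.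
have := inner_norm (x + y).
by rewrite linearDl /= !linearDr /= xy yx addr0 add0r !inner_norm => -[<-].
Qed.

Lemma pythagoras_sum (s : seq int) (f : int -> H) : uniq s ->
  {in s &, forall m n, m <> n -> inner (f m) (f n) = 0} ->
  rnorm (\sum_(n <- s) f n) ^+ 2 = \sum_(n <- s) rnorm (f n) ^+ 2.
Proof.
elim: s => [|a s IH /=]; first by rewrite !big_nil rnorm0 expr0n.
move=> /andP[aNs us] h; rewrite !big_cons pythagoras ?IH //.
  by move=> m n ms ns; apply: h; rewrite inE ?ms ?ns orbT.
apply: inner_sum => i si; apply: h; rewrite ?mem_head ?inE ?si ?orbT //.
by move=> ai; rewrite ai si in aNs.
Qed.

(** Partial sums over finite sets are Cauchy: by Pythagoras, the square of the
    norm of what is added beyond a set that nearly exhausts the supremum of the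
    square sums is small. *)
Lemma orthogonal_series (D : set int) (f : int -> H) (c : R) :
  (forall m n, D m -> D n -> m <> n -> inner (f m) (f n) = 0) ->
  (forall F : {fset int}, [set` F] `<=` D ->
     \sum_(n <- F) rnorm (f n) ^+ 2 <= c) ->
  exists l, uncond_sum D f l.
Proof.
move=> orth hc.
pose S := [set \sum_(n <- (F : {fset int})) rnorm (f n) ^+ 2 |
             F in [set F : {fset int} | [set` F] `<=` D]].
have S0 : S !=set0.
  by exists (\sum_(n <- fset0) rnorm (f n) ^+ 2); exists fset0 => // n; rewrite /= inE.
have Ssup : has_sup S by split=> //; exists c => _ [F FD <-]; exact: hc.
pose B (F0 : {fset int}) : set H :=
  [set \sum_(n <- (F : {fset int})) f n |
    F in [set F : {fset int} | [set` F0] `<=` [set` F] /\ [set` F] `<=` D]].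
pose FF := filter_from [set F0 : {fset int} | [set` F0] `<=` D] B.
have FFp : ProperFilter FF.
  apply: filter_from_proper; last first.
    by move=> F FD; exists (\sum_(n <- F) f n), F => //; split=> //; exact: subset_refl.
  apply: filter_from_filter.
    by exists fset0 => n; rewrite /= inE.
  move=> F0 F1 F0D F1D; exists (F0 `|` F1)%fset.
    by move=> n /=; rewrite inE => /orP[/F0D|/F1D].
  move=> _ [F [F01 FD] <-]; split; exists F => //; split => // n /= nF;
    by apply: F01; rewrite /= inE nF ?orbT.
have [e e0|l hl] := complete_filter FFp.
  have [_ [F0 F0D <-] hF0] : exists2 t, S t & sup S - e ^+ 2 < t.
    by apply: sup_adherent => //; rewrite exprn_gt0.
  exists (\sum_(n <- F0) f n); exists F0 => // _ [F [F0F FD] <-] /=.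
  rewrite rnorm_distC -(@ltr_pXn2r _ 2) ?nnegrE ?rnorm_ge0 ?ltW //.
  have F0F' : (F0 `<=` F)%fset by apply/fsubsetP => n; exact: F0F.
  rewrite (big_fsetID _ (mem F0)) /=.
  have -> : [fset x in F | x \in F0]%fset = F0.
    apply/fsetP => n; rewrite !inE /=; apply/andP/idP => [[]//|nF0].
    by split=> //; exact: F0F.
  rewrite addrC addrK pythagoras_sum ?fset_uniq //; last first.
    by move=> m n; rewrite !inE => /andP[/FD Dm _] /andP[/FD Dn _]; exact: orth.
  have : S (\sum_(n <- F) rnorm (f n) ^+ 2) by exists F.
  move=> /(sup_upper_bound Ssup).
  rewrite (big_fsetID _ (mem F0)) /=.
  have -> : [fset x in F | x \in F0]%fset = F0.
    apply/fsetP => n; rewrite !inE /=; apply/andP/idP => [[]//|nF0].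
    by split=> //; exact: F0F.
  move: hF0 => + h; rewrite ltrBlDr => h'.
  rewrite -(ltrD2l (\sum_(n <- F0) rnorm (f n) ^+ 2)).
  exact: le_lt_trans h h'.
exists l => e /hl[F0 F0D h]; exists F0 => // F F0F FD.
by rewrite rnorm_distC; apply: h; exists F.
Qed.

(** Split x into its component along y and an orthogonal remainder, and drop
    the remainder. *)
Lemma inner_cauchy_schwarz x y : rnorm (inner x y) <= rnorm x * rnorm y.
Proof.
have [->|y0] := eqVneq y 0; first by rewrite linear0r !rnorm0 mulr0.
have yy : inner y y != 0.
  rewrite inner_norm; apply/eqP => -[/eqP].
  by rewrite sqrf_eq0 rnorm_eq0 (negPf y0).
pose a := inner x y / inner y y.
have wy : inner (x - a *: y) (a *: y) = 0.
  by rewrite linearZr_LR linearBl linearZl_LR /= divfK // subrr mulr0.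
have := pythagoras wy; rewrite subrK => xE.
have ay : rnorm (a *: y) <= rnorm x.
  by rewrite -(@ler_pXn2r _ 2) ?nnegrE ?rnorm_ge0 // xE lerDr sqr_ge0.
have -> : rnorm (inner x y) = rnorm (a *: y) * rnorm y.
  rewrite rnormZ /a rnormM rnormV inner_norm rnorm_real ?sqr_ge0 //.
  by field; rewrite rnorm_eq0.
by rewrite ler_wpM2r ?rnorm_ge0.
Qed.

Lemma inner_small x y : (forall e : R, 0 < e -> exists2 x', inner x' y = 0 &
  rnorm (x - x') < e) -> inner x y = 0.
Proof.
move=> h; apply/eqP; rewrite -rnorm_eq0 eq_le rnorm_ge0 andbT.
apply/ler_addgt0Pr => e e0; rewrite add0r.
have y1 : 0 < rnorm y + 1 by rewrite ltr_wpDl ?rnorm_ge0.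
have [x' x'y xx'] := h _ (divr_gt0 e0 y1).
rewrite -(subrK x' x) linearDl /= x'y addr0.
apply: le_trans (inner_cauchy_schwarz _ _) _.
move: xx'; rewrite ltr_pdivlMr // => xx'; have := rnorm_ge0 (x - x'); nra.
Qed.

End Orthogonal.

(** * Finite sums of squares *)

Section SquareSums.
Variables (R : realType) (T : eqType).
Implicit Types (s : seq T) (a b : T -> R) (c d : R).

Lemma sum_sqr_ge0 s a : 0 <= \sum_(i <- s) a i ^+ 2.
Proof. by apply: sumr_ge0 => i _; exact: sqr_ge0. Qed.

Lemma cauchy_schwarz_seq s a b :
  (\sum_(i <- s) a i * b i) ^+ 2 <=
  (\sum_(i <- s) a i ^+ 2) * (\sum_(i <- s) b i ^+ 2).
Proof.
elim: s => [|i s IH]; first by rewrite !big_nil expr0n mul0r.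
rewrite !big_cons.
have A0 := sum_sqr_ge0 s a; have B0 := sum_sqr_ge0 s b.
move: (\sum_(j <- s) a j * b j) IH => S.
move: (\sum_(j <- s) a j ^+ 2) A0 => A A0.
move: (\sum_(j <- s) b j ^+ 2) B0 => B B0 IH.
move: (a i) (b i) => x y.
suff h : 2 * S * (x * y) <= A * y ^+ 2 + B * x ^+ 2 by nra.
apply: le_trans (ler_norm _) _.
have p0 : 0 <= A * y ^+ 2 + B * x ^+ 2.
  by apply: addr_ge0; apply: mulr_ge0 => //; exact: sqr_ge0.
rewrite -(@ler_pXn2r _ 2) ?nnegrE //.
rewrite real_normK ?num_real //.
have h1 : (2 * S * (x * y)) ^+ 2 <= 4 * (A * B) * (x * y) ^+ 2.
  have -> : (2 * S * (x * y)) ^+ 2 = 4 * S ^+ 2 * (x * y) ^+ 2 by ring.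
  by rewrite ler_wpM2r ?sqr_ge0 // ler_wpM2l.
apply: le_trans h1 _; rewrite -subr_ge0.
have -> : (A * y ^+ 2 + B * x ^+ 2) ^+ 2 - 4 * (A * B) * (x * y) ^+ 2 =
          (A * y ^+ 2 - B * x ^+ 2) ^+ 2 by ring.
exact: sqr_ge0.
Qed.

Lemma minkowski_seq s a b c d : 0 <= c -> 0 <= d ->
  \sum_(i <- s) a i ^+ 2 <= c ^+ 2 -> \sum_(i <- s) b i ^+ 2 <= d ^+ 2 ->
  \sum_(i <- s) (a i + b i) ^+ 2 <= (c + d) ^+ 2.
Proof.
move=> c0 d0 ac bd.
have -> : \sum_(i <- s) (a i + b i) ^+ 2 = \sum_(i <- s) a i ^+ 2 +
    (\sum_(i <- s) b i ^+ 2 + 2 * \sum_(i <- s) a i * b i).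
  by rewrite mulr_sumr -!big_split; apply: eq_bigr => i _ /=; ring.
have : \sum_(i <- s) a i * b i <= c * d.
  apply: le_trans (ler_norm _) _.
  rewrite -(@ler_pXn2r _ 2) ?nnegrE ?mulr_ge0 // real_normK ?num_real // exprMn.
  apply: le_trans (cauchy_schwarz_seq _ _ _) _.
  by apply: ler_pM => //; exact: sum_sqr_ge0.
nra.
Qed.

(** Passing to the limit in a sum of squares: the approximation b is chosen
    for the whole family, and may depend on the precision e in any way. *)
Lemma sqr_sum_closed s a c : 0 <= c ->
  (forall e, 0 < e -> exists b, [/\ {in s, forall i, 0 <= b i},
     {in s, forall i, `|a i| <= b i + e} &
     \sum_(i <- s) b i ^+ 2 <= c ^+ 2]) ->
  \sum_(i <- s) a i ^+ 2 <= c ^+ 2.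
Proof.
move=> c0 h; apply/ler_addgt0Pr => e e0.
set n : R := (size s)%:R.
have n0 : 0 <= n by rewrite ler0n.
set K := (2 * c * n + n).
have K0 : 0 <= K by rewrite addr_ge0 ?mulr_ge0.
have d0 : 0 < e / (K + 1) by rewrite divr_gt0 // ltr_wpDl.
set d := Num.min 1 (e / (K + 1)).
have dp : 0 < d by rewrite lt_min ltr01.
have d1 : d <= 1 by rewrite ge_min lexx.
have [b [b0 ab bc]] := h _ dp.
have bic i : i \in s -> b i <= c.
  move=> si; rewrite -(@ler_pXn2r _ 2) ?nnegrE ?b0 //; apply: le_trans bc.
  rewrite (big_rem i) //= lerDl; exact: sum_sqr_ge0.
apply: (@le_trans _ _ (\sum_(i <- s) (b i ^+ 2 + d * (2 * c + 1)))).
  rewrite !big_seq; apply: ler_sum => i si.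
  rewrite -real_normK ?num_real //; apply: (@le_trans _ _ ((b i + d) ^+ 2)).
    by rewrite ler_pXn2r ?nnegrE ?ab // addr_ge0 ?b0 // ltW.
  have := bic _ si; have := b0 _ si; nra.
rewrite big_split /= big_const_seq count_predT iter_addr_0.
apply: lerD => //.
have -> : d * (2 * c + 1) *+ size s = d * K.
  by rewrite -[LHS]mulr_natr -/n /K; ring.
apply: (@le_trans _ _ (e / (K + 1) * K)).
  by rewrite ler_wpM2r // ge_min lexx orbT.
by rewrite mulrAC ler_pdivrMr ?ltr_wpDl // ler_wpM2l ?(ltW e0) // lerDl.
Qed.

Lemma ler_sum_uniq s s' (f : T -> R) :
  uniq s -> uniq s' -> {subset s <= s'} -> (forall i, 0 <= f i) ->
  \sum_(i <- s) f i <= \sum_(i <- s') f i.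
Proof.
move=> us us' ss' f0.
have ps : perm_eq s [seq i <- s' | i \in s].
  apply: uniq_perm; rewrite ?filter_uniq // => i; rewrite mem_filter.
  by case: (boolP (i \in s)) => // /ss' ->.
rewrite (perm_big _ ps) big_filter [leRHS](bigID (mem s)) /=.
by rewrite lerDl sumr_ge0.
Qed.

End SquareSums.

(** * Resolutions of the identity *)

Section Resolution.
Variables (R : realType) (H : completeNormedModType R[i]).
Variable (inner : {dot H for Num.Def.conjC}).
Hypothesis nin : norm_of_inner inner.

Variables (D : set int) (E : int -> H -> H).
Hypothesis hE : resolution_of_identity inner D E.

Lemma res_bounded n : D n -> bounded_op (E n).
Proof. by case: hE => h _ _ _ /h[]. Qed.

Lemma res_lin n : D n -> linear (E n).
Proof. by move=> /res_bounded[]. Qed.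

Lemma res_idem n x : D n -> E n (E n x) = E n x.
Proof. by case: hE => h _ _ _ /h[_ /(congr1 (@^~ x))]. Qed.

Lemma res_adj n x y : D n -> inner (E n x) y = inner x (E n y).
Proof. by case: hE => _ h _ _ /h. Qed.

Lemma res_orth m n x : D m -> D n -> m <> n -> E m (E n x) = 0.
Proof. by move=> Dm Dn mn; case: hE => _ _ /(_ m n Dm Dn mn)/(congr1 (@^~ x)). Qed.

Lemma res_sum x : uncond_sum D (fun n => E n x) x.
Proof. by case: hE. Qed.

Lemma res_perp m n x y : D m -> D n -> m <> n -> inner (E m x) (E n y) = 0.
Proof. by move=> Dm Dn mn; rewrite res_adj // res_orth // linear0r. Qed.

Lemma res_sum_coord (F : {fset int}) (f : int -> H) k : [set` F] `<=` D ->
  (forall n, n \in F -> E n (f n) = f n) -> D k ->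
  E k (\sum_(n <- F) f n) = if k \in F then f k else 0.
Proof.
move=> FD hf Dk; rewrite lin_sum; last exact: res_lin.
case: ifP => kF.
  rewrite (big_fsetD1 k) //= hf // big_seq big1 ?addr0 // => n.
  rewrite !inE => /andP[/eqP nk nF]; rewrite -hf // res_orth //; last by auto.
  exact: FD.
rewrite big_seq big1 // => n nF; rewrite -hf // res_orth //; first exact: FD.
by move=> kn; rewrite kn nF in kF.
Qed.

(** The partial sum y is orthogonal to x - y, and Pythagoras applies twice. *)
Lemma res_bessel x (F : {fset int}) : [set` F] `<=` D ->
  \sum_(n <- F) rnorm (E n x) ^+ 2 <= rnorm x ^+ 2.
Proof.
move=> FD; pose y := \sum_(n <- F) E n x.
have -> : \sum_(n <- F) rnorm (E n x) ^+ 2 = rnorm y ^+ 2.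
  rewrite (pythagoras_sum nin) ?fset_uniq // => m n /FD Dm /FD Dn.
  exact: res_perp.
have xy : inner (x - y) y = 0.
  apply: inner_sum => n nF; have Dn := FD _ nF.
  rewrite -res_idem // -res_adj // linB; last exact: res_lin.
  rewrite res_sum_coord // => [|m mF]; last by rewrite res_idem //; exact: FD.
  by rewrite nF subrr linear0l.
have := pythagoras nin xy; rewrite subrK => ->.
by rewrite lerDr sqr_ge0.
Qed.

Lemma res_contr n x : D n -> rnorm (E n x) <= rnorm x.
Proof.
move=> Dn; rewrite -(@ler_pXn2r _ 2) ?nnegrE ?rnorm_ge0 //.
have := @res_bessel x [fset n]%fset; rewrite big_seq_fset1; apply.
by move=> k /=; rewrite inE => /eqP->.
Qed.

Lemma res_inj x y : (forall n, D n -> E n x = E n y) -> x = y.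
Proof.
move=> h; apply: (@uncond_sum_unique _ _ D (fun n => E n x)).
  exact: res_sum.
by apply: uncond_sum_ext (res_sum y) => n Dn; rewrite h.
Qed.

Lemma res_coord k f l (S : set int) : S `<=` D -> uncond_sum S f l ->
  (forall n, S n -> E n (f n) = f n) -> D k ->
  E k l = if k \in S then f k else 0.
Proof.
move=> SD fl hf Dk.
have h := uncond_sum_lin (res_bounded Dk) fl; case: ifP => [/[!inE] kS|kS].
  apply: (uncond_sum_unique h); rewrite -(hf _ kS).
  apply: (@uncond_sum1 _ _ S k (fun n => E k (f n))) => // n Sn nk.
  by rewrite -hf // res_orth //; auto.
apply: (uncond_sum_unique h); apply: uncond_sum0 => n Sn.
rewrite -hf // res_orth //; first exact: SD.
by move=> kn; have : k \in S; [rewrite inE kn|rewrite kS].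
Qed.

(** An operator is assembled from its rows: the ranges of distinct rows are
    orthogonal, so square summability of the X n x is all that the series needs.
    The block projections, J and Gamma are all obtained in this way. *)
Lemma opsum_res (S : set int) (X : int -> H -> H) (c : R) : S `<=` D ->
  (forall n, S n -> linear (X n)) ->
  (forall n x, S n -> E n (X n x) = X n x) -> 0 <= c ->
  (forall x (F : {fset int}), [set` F] `<=` S ->
     \sum_(n <- F) rnorm (X n x) ^+ 2 <= (c * rnorm x) ^+ 2) ->
  [/\ bounded_op (opsum S X),
      forall x, rnorm (opsum S X x) <= c * rnorm x,
      forall x, uncond_sum S (fun n => X n x) (opsum S X x) &
      forall n x, D n -> E n (opsum S X x) = if n \in S then X n x else 0].
Proof.
move=> SD lX hX c0 hc.
have orth m n x y : S m -> S n -> m <> n -> inner (X m x) (X n y) = 0.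
  by move=> Sm Sn mn; rewrite -hX // -(hX n) // res_perp //; exact: SD.
have ex x : exists l, uncond_sum S (fun n => X n x) l.
  by apply: (orthogonal_series nin) (hc x) => m n; exact: orth.
pose Y x := xget 0 [set l | uncond_sum S (fun n => X n x) l].
have hY x : uncond_sum S (fun n => X n x) (Y x).
  by apply: (@xgetPex _ 0 [set l | uncond_sum S (fun n => X n x) l]); exact: ex.
have Yc x : rnorm (Y x) <= c * rnorm x.
  apply: uncond_sum_le (hY x) _ => F FS.
  rewrite -(@ler_pXn2r _ 2) ?nnegrE ?mulr_ge0 ?rnorm_ge0 //.
  rewrite (pythagoras_sum nin) ?fset_uniq //; first exact: hc.
  by move=> m n /FS Sm /FS Sn; exact: orth.
have lY : linear Y.
  move=> a x y; apply: uncond_sum_unique (hY _) _.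
  apply: (@uncond_sum_ext _ _ _ (fun n => a *: X n x + X n y)).
    by move=> n Sn; rewrite lX.
  apply: uncond_sumD (hY y).
  exact: (uncond_sum_lin (bounded_opZ a (@bounded_op_id _ _)) (hY x)).
have bY : bounded_op Y by apply: bounded_opI Yc.
have [bs us] : bounded_op (opsum S X) /\
    forall x, uncond_sum S (fun n => X n x) (opsum S X x).
  by apply: (@xgetPex _ 0 [set Y | bounded_op Y /\
    forall x, uncond_sum S (fun n => X n x) (Y x)]); exists Y.
split=> // [x|n x Dn].
  by rewrite (uncond_sum_unique (us x) (hY x)); exact: Yc.
by apply: res_coord (us x) _ Dn => // m Sm; exact: hX.
Qed.

Lemma res_norm_le x c : 0 <= c ->
  (forall F : {fset int}, [set` F] `<=` D ->
     \sum_(n <- F) rnorm (E n x) ^+ 2 <= c ^+ 2) -> rnorm x <= c.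
Proof.
move=> c0 h; apply: uncond_sum_le (res_sum x) _ => F FD.
rewrite -(@ler_pXn2r _ 2) ?nnegrE ?rnorm_ge0 //.
rewrite (pythagoras_sum nin) ?fset_uniq //; first exact: h.
by move=> m n /FD Dm /FD Dn; exact: res_perp.
Qed.

Lemma op_ext X Y : bounded_op X -> bounded_op Y ->
  (forall m n x, D m -> D n -> E m (X (E n x)) = E m (Y (E n x))) -> X = Y.
Proof.
move=> bX bY h; apply/funext => x.
apply: (@uncond_sum_unique _ _ D (fun n => X (E n x))).
  exact/uncond_sum_lin/(res_sum _).
apply: (@uncond_sum_ext _ _ _ (fun n => Y (E n x))).
  by move=> n Dn; apply: res_inj => m Dm; rewrite h.
exact/uncond_sum_lin/(res_sum _).
Qed.

(** A partial sum of u is orthogonal to v term by term, and it approximates u. *)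
Lemma res_disjoint u v : (forall k, D k -> E k u = 0 \/ E k v = 0) ->
  inner u v = 0.
Proof.
move=> h; apply: (inner_small nin) => e e0.
have [F FD hF] := res_sum u e0.
exists (\sum_(n <- F) E n u); last first.
  by rewrite rnorm_distC; apply: hF => //; exact: subset_refl.
apply: inner_eq0C; apply: inner_sum => n /FD Dn.
rewrite -res_idem // -res_adj //.
by have [->|->] := h n Dn; rewrite ?linear0l ?linear0r.
Qed.

Definition diag_op (S : set int) (d : int -> R[i]) : H -> H :=
  opsum S (fun n x => d n *: E n x).

Lemma diag_opP (S : set int) (d : int -> R[i]) (c : R) : S `<=` D ->
  0 <= c -> (forall n, S n -> rnorm (d n) <= c) ->
  [/\ bounded_op (diag_op S d),
      forall x, rnorm (diag_op S d x) <= c * rnorm x,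
      forall x, uncond_sum S (fun n => d n *: E n x) (diag_op S d x) &
      forall n x, D n ->
        E n (diag_op S d x) = if n \in S then d n *: E n x else 0].
Proof.
move=> SD c0 hd; apply: opsum_res => // [n Sn|n x Sn|x F FS].
- by have [] := bounded_opZ (d n) (res_bounded (SD _ Sn)).
- by rewrite linZ ?res_idem //; [exact: SD|exact/res_lin/SD].
rewrite exprMn; apply: le_trans (ler_wpM2l (sqr_ge0 c) (res_bessel x _)).
  rewrite mulr_sumr !big_seq; apply: ler_sum => n /FS Sn.
  by rewrite rnormZ exprMn ler_wpM2r ?sqr_ge0 // ler_pXn2r ?nnegrE ?rnorm_ge0 ?hd.
by move=> n /FS/SD.
Qed.

End Resolution.

(** * Neumann series and inverses *)

Section Neumann.
Variables (R : realType) (H : completeNormedModType R[i]).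
Implicit Types (T W S : H -> H).

(** The solution of x + T x = y is the limit of the iteration x := y - T x;
    injectivity of I + T then makes the solution linear in y. *)
Lemma neumann T (q : R) : bounded_op T -> 0 <= q < 1 ->
  (forall x, rnorm (T x) <= q * rnorm x) -> invertible (id + T).
Proof.
move=> bT q01 hT; have /andP[q0 q1] := q01; have lT := bT.1.
have inj x y : x + T x = y + T y -> x = y.
  move=> xy; apply/eqP; rewrite -subr_eq0 -rnorm_eq0.
  have E : x - y = - T (x - y).
    by rewrite linB // opprB; apply/eqP; rewrite subr_eq addrAC eq_sym subr_eq xy addrC.
  have := hT (x - y); rewrite -(rnormN (T _)) -E.
  by move=> h; have := rnorm_ge0 (x - y) => h'; apply/eqP; nra.
have ex y : exists x, x + T x = y.
  pose f n := iter n (fun x => y - T x) 0.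
  have [n|l hl] := geometric_cvg (rnorm_ge0 y) q01
    (_ : forall n, rnorm (f n.+1 - f n) <= rnorm y * q ^+ n).
    elim: n => [|n IH]; first by rewrite /f /= lin0 // !subr0 mulr1.
    rewrite {1}/f iterS -/(f n.+1) [in X in _ - X]/f iterS -/(f n).
    rewrite opprB addrC subrKA -linB //.
    rewrite rnorm_distC in IH.
    by apply: le_trans (hT _) _; rewrite exprS mulrCA ler_wpM2l.
  exists l; apply: eq_rnorm_small => e e0.
  set K := rnorm y / (1 - q) in hl.
  have K0 : 0 <= K by rewrite divr_ge0 ?rnorm_ge0 // subr_ge0 ltW.
  have [N hN] := expr_small q01 e0 (addr_ge0 K0 K0); apply: le_lt_trans (hN N (leqnn _)).
  have -> : l + T l - y = - ((f N.+1 - l) + T (f N - l)).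
    have -> : f N.+1 = y - T (f N) by [].
    by rewrite linB // [y - _ - l]addrAC subrKA !opprB addrA (addrC (T l)).
  rewrite rnormN mulrDl; apply: le_trans (ler_rnormD _ _) _.
  apply: lerD.
    apply: le_trans (hl _) _; rewrite exprS; apply: ler_wpM2l => //.
    by rewrite ler_piMl ?exprn_ge0 // ltW.
  apply: le_trans (hT _) _; apply: le_trans (hl N).
  by rewrite ler_piMl ?rnorm_ge0 // ltW.
have [N hN] := choice ex.
split; first exact: bounded_opD (@bounded_op_id _ _) bT.
exists N; split; last 2 first.
- by apply/funext => x /=; rewrite fctE hN.
- by apply/funext => x /=; apply: inj; rewrite hN fctE.
have lN : linear N.
  move=> a x y; apply: inj; rewrite hN lT addrACA -scalerDr !hN //.
have q1' : 0 < 1 - q by rewrite subr_gt0.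
apply: (@bounded_opI _ _ _ (1 - q)^-1) => // [|x]; first by rewrite invr_ge0 ltW.
rewrite mulrC ler_pdivlMr // mulrBr mulr1 lerBlDr.
rewrite -{2}(hN x); apply: le_trans (ler_rnorm_dist _ (N x + T (N x))) _.
by rewrite lerD2l opprD addrA subrr add0r rnormN mulrC.
Qed.

Lemma opinvP W : invertible W ->
  [/\ bounded_op (opinv W), forall x, W (opinv W x) = x &
      forall x, opinv W (W x) = x].
Proof.
move=> [_ ex].
have [b h1 h2] := @xgetPex _ 0
  [set W' | [/\ bounded_op W', W \o W' = id & W' \o W = id]] ex.
by split=> // x; [have := congr1 (@^~ x) h1|have := congr1 (@^~ x) h2].
Qed.

Lemma opinv_invertible W : invertible W -> invertible (opinv W).
Proof.
move=> iW; have [b h1 h2] := opinvP iW; split=> //; exists W.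
by split; [case: iW|apply/funext|apply/funext].
Qed.

End Neumann.

(** * Resolvents on reducing subspaces *)

Section Resolvents.
Variables (R : realType) (H : completeNormedModType R[i]).
Implicit Types (T : operator H) (S W V E : H -> H) (M : set H) (z : R[i]).

Lemma linear_operatorD T x y : linear_operator T -> dom T x -> dom T y ->
  dom T (x + y) /\ T (x + y) = T x + T y.
Proof. by move=> [_ h] dx dy; have := h 1 x y dx dy; rewrite !scale1r. Qed.

Lemma linear_operatorB T x y : linear_operator T -> dom T x -> dom T y ->
  dom T (x - y) /\ T (x - y) = T x - T y.
Proof.
move=> [_ h] dx dy; have := h (-1) y x dy dx.
by rewrite !scaleN1r ![- _ + _]addrC.
Qed.

Lemma linear_operator_sub T V : linear_operator T -> linear V ->
  linear_operator (op_sub T V).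
Proof.
move=> [d0 h] lV; split=> // a x y dx dy; have [d e] := h a x y dx dy.
by split=> //=; rewrite e lV scalerBr opprD addrACA.
Qed.

Definition reduces T E :=
  forall x, dom T x -> dom T (E x) /\ T (E x) = E (T x).

Lemma resolvent_transport T1 T2 W M z S : similarity T1 T2 W ->
  is_resolvent_on T2 M z S ->
  is_resolvent_on T1 (W @` M) z (W \o S \o opinv W).
Proof.
move=> [iW domW TW] [bS S1 S2]; have [bW' W1 W2] := opinvP iW.
have lW := iW.1.1.
have key x : dom T2 x -> T1 (W x) - z *: W x = W (T2 x - z *: x).
  by move=> dx; rewrite TW // (linB _ _ lW) (linZ _ _ lW).
split.
- by apply: bounded_op_comp bW'; apply: bounded_op_comp => //; case: iW.
- move=> _ [y My <-] /=; rewrite W2; have [MS dS E] := S1 y My.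
  split; first by exists (S y).
    by rewrite -domW; exists (S y).
  by rewrite key ?E.
move=> _ [x Mx <-]; rewrite -domW => -[x' dx' xx'] /=.
have E : x' = x by rewrite -(W2 x') xx' W2.
by rewrite -E in Mx *; rewrite key // W2 S2.
Qed.

Lemma similarity_sym T1 T2 W : similarity T1 T2 W -> similarity T2 T1 (opinv W).
Proof.
move=> [iW domW TW]; have [bW' W1 W2] := opinvP iW; split.
- exact: opinv_invertible.
- rewrite -domW; apply/seteqP; split=> [_ [_ [x dx <-] <-]|x dx]; first by rewrite W2.
  by exists (W x); rewrite ?W2 //; exists x.
by move=> x; rewrite -domW => -[y dy <-]; rewrite W2 TW // W2.
Qed.

Lemma spectrum_on_similarity T1 T2 W M : similarity T1 T2 W ->
  spectrum_on T1 (W @` M) = spectrum_on T2 M.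
Proof.
move=> sim; have [iW _ _] := sim; have [_ W1 W2] := opinvP iW.
apply/seteqP; split=> z h [S hS]; apply: h.
  by exists (W \o S \o opinv W); exact: (resolvent_transport sim hS).
have := resolvent_transport (similarity_sym sim) hS.
have -> : opinv W @` (W @` M) = M.
  apply/seteqP; split=> [_ [_ [x Mx <-] <-]|x Mx]; first by rewrite W2.
  by exists (W x); rewrite ?W2 //; exists x.
by move=> h; exists (opinv W \o S \o opinv (opinv W)).
Qed.

Lemma resolvent_restrict T E z S : reduces T E -> linear E ->
  is_resolvent_on T setT z S -> is_resolvent_on T [set x | E x = x] z S.
Proof.
move=> red lE [bS S1 S2]; split=> // [y /= Ey|x _ dx]; last exact: S2.
have [_ dS ES] := S1 y I; split=> //=.
have [dES TES] := red _ dS.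
have := S2 (E (S y)) I dES; rewrite TES -(linZ _ _ lE) -(linB _ _ lE) ES Ey.
by move=> <-.
Qed.

(** A resolvent on the whole space is the direct sum of the resolvents on the
    range and on the kernel of E. *)
Lemma resolvent_combine T E z S1 S2 : linear_operator T -> reduces T E ->
  bounded_op E -> E \o E = E ->
  is_resolvent_on T [set x | E x = x] z S1 ->
  is_resolvent_on T [set x | E x = 0] z S2 ->
  exists S, is_resolvent_on T setT z S.
Proof.
move=> lT red bE EE [bS1 h1 h1'] [bS2 h2 h2']; have lE := bE.1.
have Ei x : E (E x) = E x by exact: (congr1 (@^~ x) EE).
have K x : E (x - E x) = 0 by rewrite (linB _ _ lE) Ei subrr.
exists ((S1 \o E) + (S2 \o (id - E))); split.
- apply: bounded_opD; first exact: bounded_op_comp.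
  by apply: bounded_op_comp => //; apply: bounded_opB => //; exact: bounded_op_id.
- move=> y _; rewrite !fctE /=.
  have [_ d1 e1] := h1 (E y) (Ei y); have [_ d2 e2] := h2 (y - E y) (K y).
  have [d ->] := linear_operatorD lT d1 d2; split=> //.
  by rewrite scalerDr opprD addrACA e1 e2 addrC subrK.
move=> x _ dx; rewrite !fctE /=; have [dEx TEx] := red x dx.
have -> : E (T x - z *: x) = T (E x) - z *: E x.
  by rewrite (linB _ _ lE) (linZ _ _ lE) TEx.
rewrite h1' //=.
have [dxE TxE] := linear_operatorB lT dx dEx.
have -> : T x - z *: x - (T (E x) - z *: E x) = T (x - E x) - z *: (x - E x).
  rewrite TxE scalerBr !opprB addrACA [RHS]addrACA; congr (_ + _); exact: addrC.
by rewrite h2' //= addrC subrK.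
Qed.

(** From A - V - z = (I - V S) (A - z): the inverse is S (I - V S)^-1, and
    it respects the range of E because the Neumann series commutes with E. *)
Lemma resolvent_perturb T E V z S (q : R) : linear_operator T ->
  bounded_op E -> bounded_op V ->
  is_resolvent_on T [set x | E x = x] z S ->
  S \o E = E \o S -> V \o E = E \o V ->
  0 <= q < 1 -> (forall x, rnorm (V (S x)) <= q * rnorm x) ->
  exists S', is_resolvent_on (op_sub T V) [set x | E x = x] z S'.
Proof.
move=> lT bE bV [bS S1 S2] SE VE q01 hq; have lE := bE.1; have lV := bV.1.
have {}SE x : S (E x) = E (S x) by exact: (congr1 (@^~ x) SE).
have {}VE x : V (E x) = E (V x) by exact: (congr1 (@^~ x) VE).
have bVS : bounded_op (- (V \o S)) by apply/bounded_opN/bounded_op_comp.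
have hq' x : rnorm ((- (V \o S)) x) <= q * rnorm x.
  by have := hq x; rewrite -rnormN.
have [bN [N [bN' N1 N2]]] := neumann bVS q01 hq'.
have {}N1 x : N x - V (S (N x)) = x by exact: (congr1 (@^~ x) N1).
have {}N2 x : N (x - V (S x)) = x by exact: (congr1 (@^~ x) N2).
have NE x : N (E x) = E (N x).
  rewrite -{1}(N1 x) linB // -VE -SE.
  by rewrite N2.
exists (S \o N); split.
- exact: bounded_op_comp.
- move=> y /= Ey; have ENy : E (N y) = N y by rewrite -NE Ey.
  have [/= MS dS ES] := S1 _ ENy; split=> //.
  by rewrite addrAC ES N1.
move=> x /= Ex dx; have := S2 x Ex dx; set w := T x - z *: x => Sw.
by rewrite addrAC -/w -{1}Sw N2.
Qed.

End Resolvents.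

(** * Block projections and the transforms J and Gamma *)

Section Blocks.
Variables (R : realType) (H : completeNormedModType R[i]).
Variable (inner : {dot H for Num.Def.conjC}).
Hypothesis nin : norm_of_inner inner.

Variables (P : int -> H -> H).
Hypothesis hP : resolution_of_identity inner setT P.

Lemma comp_proj k l x : P k (P l x) = if k == l then P k x else 0.
Proof.
case: eqP => [->|kl]; first by rewrite (res_idem hP).
by rewrite (res_orth hP).
Qed.

Variables (lam : int -> R[i]) (I : set int) (sigma : int -> set R[i]).
(* blk k is the index of the block that contains the eigenvalue lam k. *)
Variable (blk : int -> int).
Hypothesis blkI : forall k, I (blk k).
Hypothesis blkP : forall n k, I n -> sigma n (lam k) <-> blk k = n.

Local Notation Q := (block_proj P lam sigma).
Local Notation J := (JSigma P lam I sigma).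

Lemma block_projP n : [/\ bounded_op (Q n), forall x, rnorm (Q n x) <= rnorm x
  & forall k x, I n -> P k (Q n x) = if blk k == n then P k x else 0].
Proof.
have [||x F _|h1 h2 h3 h4] := @opsum_res _ _ inner nin _ _ hP
    [set k | sigma n (lam k)] P 1 (@subsetT _ _) _ _ ler01.
- by move=> k _; exact: (res_lin hP).
- by move=> k x _; exact: (res_idem hP).
- by rewrite mul1r; apply: (res_bessel nin hP).
split=> // [x|k x In]; first by have := h2 x; rewrite mul1r.
rewrite h4 //; case: (eqVneq (blk k) n) => [kn|/eqP kn].
  by rewrite ifT // inE /=; apply/blkP.
by rewrite ifF //; apply/negP => /[!inE] /= /(@blkP n k In).
Qed.

Lemma bounded_block_proj n : bounded_op (Q n). Proof. by case: (block_projP n). Qed.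

Lemma linear_block_proj n : linear (Q n). Proof. by case: (bounded_block_proj n). Qed.

Lemma proj_block n k x : I n -> P k (Q n x) = if blk k == n then P k x else 0.
Proof. by case: (block_projP n) => _ _; exact. Qed.

Lemma block_of_proj n k x : I n -> Q n (P k x) = if blk k == n then P k x else 0.
Proof.
move=> In; apply: (res_inj hP) => j _; rewrite proj_block // comp_proj.
case: (eqVneq j k) => [->|jk].
  by case: eqP => _; rewrite ?(res_idem hP) // (lin0 (res_lin hP _)).
rewrite if_same; case: ifP => _; last by rewrite (lin0 (res_lin hP _)).
by rewrite comp_proj (negPf jk).
Qed.

(** For the convergence, let F0 nearly exhaust x in the finer decomposition.
    If G contains the blocks met by F0, then the sum S over G is a projection which
    fixes the partial sum over F0, so x - S x is the image by the contraction
    I - S of a small vector. *)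
Lemma resolution_block_proj : resolution_of_identity inner I Q.
Proof.
have idem n x : I n -> Q n (Q n x) = Q n x.
  by move=> In; apply: (res_inj hP) => k _; rewrite !proj_block //; case: (blk k == n).
split=> [n In|n In x y|m n Im In mn|x].
- by split; [exact: bounded_block_proj|apply/funext => x /=; exact: idem].
- have lQ := linear_block_proj n.
  have h u v : inner (Q n u) (v - Q n v) = 0.
    apply: (res_disjoint nin hP) => k _.
    rewrite (linB _ _ (res_lin hP _)) // !proj_block //.
    by case: (blk k == n); [right; rewrite subrr|left].
  rewrite -{1}(subrK (Q n y) y) linearDr /= h add0r.
  by rewrite -{2}(subrK (Q n x) x) linearDl /= (inner_eq0C (h y x)) add0r.
- apply/funext => x /=; apply: (res_inj hP) => k _; rewrite !proj_block //.
  rewrite (lin0 (res_lin hP _)) //; case: eqP => // km; case: eqP => // kn.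
  by case: mn; rewrite -km kn.
move=> e e0; have [F0 _ h0] := res_sum hP x e0.
exists (blk @` F0)%fset => [n /=|G G0 GI].
  by move=> /imfsetP[k _ ->]; exact: blkI.
pose S y := \sum_(n <- G) Q n y.
have lS : linear S.
  move=> a y z; rewrite /S scaler_sumr -big_split; apply: eq_bigr => n _.
  exact: linear_block_proj.
have PS k y : P k (S y) = if blk k \in G then P k y else 0.
  rewrite /S lin_sum; last exact: (res_lin hP).
  case: ifP => kG; last first.
    rewrite big_seq big1 // => n nG; rewrite proj_block; last exact: GI.
    by rewrite ifF //; apply/negP => /eqP kn; rewrite kn nG in kG.
  rewrite (big_fsetD1 (blk k)) //= proj_block ?eqxx // big_seq big1 ?addr0 // => n.
  rewrite !inE => /andP[nk nG]; rewrite proj_block; last exact: GI.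
  by rewrite eq_sym (negPf nk).
have SP : S (\sum_(k <- F0) P k x) = \sum_(k <- F0) P k x.
  apply: (res_inj hP) => k _; rewrite PS; case: ifP => // kG.
  rewrite lin_sum; last exact: (res_lin hP).
  rewrite big_seq big1 // => j jF; rewrite (res_orth hP) // => kj.
  by move: kG; rewrite kj => /negP; apply; apply: G0; apply/imfsetP; exists j.
have contr y : rnorm (y - S y) <= rnorm y.
  apply: (res_norm_le nin hP); rewrite ?rnorm_ge0 // => F FT.
  apply: le_trans (res_bessel nin hP y FT).
  apply: ler_sum => k _; rewrite (linB _ _ (res_lin hP _)) // PS.
  by case: ifP; rewrite ?subr0 // subrr rnorm0 expr0n sqr_ge0.
rewrite -/(S x) rnorm_distC.
have -> : x - S x = (x - \sum_(k <- F0) P k x) - S (x - \sum_(k <- F0) P k x).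
  by rewrite linB // SP opprB addrA subrK.
by apply: le_lt_trans (contr _) _; rewrite rnorm_distC; apply: h0.
Qed.

Lemma comp_block m n x : I m -> I n -> Q m (Q n x) = if m == n then Q m x else 0.
Proof.
move=> Im In; case: eqP => [->|mn]; first by rewrite (res_idem resolution_block_proj).
by rewrite (res_orth resolution_block_proj).
Qed.

Lemma JSigmaP X : bounded_op X -> bounded_op (J X) /\
  forall n x, I n -> Q n (J X x) = Q n (X (Q n x)).
Proof.
move=> bX; have rQ := resolution_block_proj.
have [||x F FI|h1 h2 h3 h4] := @opsum_res _ _ inner nin _ _ rQ
    I (fun n => Q n \o X \o Q n) (opnorm X) (@subset_refl _ _) _ _ (opnorm_ge0 bX).
- move=> n In; apply: lin_comp (linear_block_proj n).
  by apply: lin_comp (bX.1); exact: linear_block_proj.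
- by move=> n x In; rewrite /= (res_idem rQ).
- rewrite exprMn; apply: le_trans (ler_wpM2l (sqr_ge0 _) (res_bessel nin rQ x FI)).
  rewrite mulr_sumr !big_seq; apply: ler_sum => n /FI In /=.
  rewrite -exprMn ler_pXn2r ?nnegrE ?mulr_ge0 ?rnorm_ge0 ?opnorm_ge0 //.
  by apply: le_trans (res_contr nin rQ _ In) _; exact: opnormP.
by split=> // n x In; rewrite h4 // ifT // inE.
Qed.

Lemma bounded_JSigma X : bounded_op X -> bounded_op (J X).
Proof. by case/JSigmaP. Qed.

Lemma block_JSigma X m n x : bounded_op X -> I m -> I n ->
  Q m (J X (Q n x)) = if m == n then Q m (X (Q n x)) else 0.
Proof.
move=> bX Im In; have [_ ->] := JSigmaP bX => //.
rewrite comp_block //; case: eqP => [->//|_].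
by rewrite (lin0 bX.1) (lin0 (linear_block_proj m)).
Qed.

(* gam stands for the square root of eta. *)
Variable (gam : R).
Hypothesis gam0 : 0 <= gam.
Hypothesis gapP : forall j (F : {fset int}), j \notin F ->
  \sum_(n <- F) (rnorm (lam n - lam j))^-1 ^+ 2 <= gam ^+ 2.

Local Notation G := (Gamma P lam).

Let gap_inv k j : R[i] := if j == k then 0 else (lam k - lam j)^-1.
(* The operator T k such that P k (Gamma X) = P k X T k. *)
Let gap_mult k := diag_op P setT (gap_inv k).

Let gap_inv_le k j : rnorm (gap_inv k j) <= gam.
Proof.
rewrite /gap_inv; case: eqP => [_|/eqP jk]; first by rewrite rnorm0.
rewrite rnormV -(@ler_pXn2r _ 2) ?nnegrE ?invr_ge0 ?rnorm_ge0 //.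
have := @gapP j [fset k]%fset; rewrite big_seq_fset1; apply.
by rewrite inE.
Qed.

Let gap_multP k : [/\ bounded_op (gap_mult k),
  forall x, rnorm (gap_mult k x) <= gam * rnorm x,
  forall x, uncond_sum setT (fun n => gap_inv k n *: P n x) (gap_mult k x) &
  forall n x, P n (gap_mult k x) = gap_inv k n *: P n x].
Proof.
have [h1 h2 h3 h4] := diag_opP nin hP (@subsetT _ setT) gam0 (fun j _ => gap_inv_le k j).
by split=> // n x; rewrite h4 // ifT // inE.
Qed.

(* Exchange the sums over k and j: the weight of |P j x|^2 is the j-th row
   sum, which is at most eta. *)
Let gap_mult_sum x (F : {fset int}) :
  \sum_(k <- F) rnorm (gap_mult k x) ^+ 2 <= (gam * rnorm x) ^+ 2.
Proof.
apply: sqr_sum_closed => [|e e0]; first by rewrite mulr_ge0 ?rnorm_ge0.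
have [|F0 [_ h0]] := @uncond_sum_common _ _ _ (F : seq int) setT
   (fun k n => gap_inv k n *: P n x) (fun k => gap_mult k x) e e0.
  by move=> k _; case: (gap_multP k).
have {}h0 := h0 F0 (@subset_refl _ _) (@subsetT _ _).
exists (fun k => rnorm (\sum_(n <- F0) gap_inv k n *: P n x)); split=> [k _|k kF|].
- exact: rnorm_ge0.
- rewrite ger0_norm ?rnorm_ge0 //.
  apply: le_trans (ler_rnorm_dist _ (\sum_(n <- F0) gap_inv k n *: P n x)) _.
  by rewrite lerD2l rnorm_distC ltW // h0.
have E k : rnorm (\sum_(n <- F0) gap_inv k n *: P n x) ^+ 2 =
    \sum_(n <- F0) rnorm (gap_inv k n) ^+ 2 * rnorm (P n x) ^+ 2.
  rewrite (pythagoras_sum nin) ?fset_uniq // => [|m n _ _ mn].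
    by apply: eq_bigr => n _; rewrite rnormZ exprMn.
  by rewrite linearZl_LR linearZr_LR /= (res_perp hP) // !mulr0.
under eq_bigr do rewrite E.
rewrite exchange_big /= exprMn.
apply: le_trans (ler_wpM2l (sqr_ge0 _) (res_bessel nin hP x (@subsetT _ [set` F0]))).
rewrite mulr_sumr; apply: ler_sum => n _; rewrite -mulr_suml.
rewrite ler_wpM2r ?sqr_ge0 //.
apply: le_trans (@gapP n (F `\ n)%fset _); last by rewrite !inE eqxx.
rewrite (big_fsetID _ (fun k => k == n)) /=.
rewrite big_seq big1 => [|k]; last first.
  by rewrite !inE => /andP[_ /eqP->]; rewrite /gap_inv eqxx rnorm0 expr0n.
rewrite add0r le_eqVlt; apply/orP; left; apply/eqP.
have -> : [fset k in F | k != n]%fset = (F `\ n)%fset.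
  by apply/fsetP => k; rewrite !inE andbC.
rewrite !big_seq; apply: eq_bigr => k; rewrite !inE => /andP[kn _].
by rewrite /gap_inv eq_sym (negPf kn) rnormV.
Qed.

(** The row k of Gamma X is P k X (T k), so that the square sum of the rows at
    x is at most c^2 times the sum of the |T k x|^2. *)
Lemma GammaP X c : bounded_op X -> 0 <= c ->
  (forall x, rnorm (X x) <= c * rnorm x) ->
  [/\ bounded_op (G X), forall x, rnorm (G X x) <= gam * c * rnorm x &
   forall m n x, P m (G X (P n x)) =
     if m == n then 0 else (lam m - lam n)^-1 *: P m (X (P n x))].
Proof.
move=> bX c0 hc.
have [||x F _|h1 h2 h3 h4] := @opsum_res _ _ inner nin _ _ hP
    setT (fun k => P k \o X \o gap_mult k) (gam * c) (@subset_refl _ _) _ _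
    (mulr_ge0 gam0 c0).
- move=> k _; case: (gap_multP k) => [[lT _] _ _ _]; apply: lin_comp lT.
  by apply: lin_comp bX.1; exact: (res_lin hP).
- by move=> k x _; rewrite /= (res_idem hP).
- apply: (@le_trans _ _ (c ^+ 2 * \sum_(k <- F) rnorm (gap_mult k x) ^+ 2)); last first.
    rewrite (mulrC gam) -(mulrA c gam) exprMn; apply: ler_wpM2l; first exact: sqr_ge0.
    exact: gap_mult_sum.
  rewrite mulr_sumr; apply: ler_sum => k _; rewrite -exprMn /=.
  rewrite ler_pXn2r ?nnegrE ?mulr_ge0 ?rnorm_ge0 //.
  by apply: le_trans (res_contr nin hP _ _) (hc _).
set Y := opsum _ _ in h1 h2 h3 h4.
have hY m n x : P m (Y (P n x)) =
     if m == n then 0 else (lam m - lam n)^-1 *: P m (X (P n x)).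
  rewrite h4 // ifT ?inE //=.
  have -> : gap_mult m (P n x) = gap_inv m n *: P n x.
    apply: (res_inj hP) => k _; case: (gap_multP m) => _ _ _ ->.
    rewrite (linZ _ _ (res_lin hP _)) // comp_proj.
    by case: eqP => [->//|_]; rewrite !scaler0.
  rewrite (linZ _ _ bX.1) (linZ _ _ (res_lin hP _)) // /gap_inv eq_sym.
  by case: eqP; rewrite ?scale0r.
have hG : bounded_op (G X) /\ forall m n x, P m (G X (P n x)) =
     if m == n then 0 else (lam m - lam n)^-1 *: P m (X (P n x)).
  by apply: (@xgetPex _ 0 [set Y | bounded_op Y /\ forall m n x,
    P m (Y (P n x)) =
      if m == n then 0 else (lam m - lam n)^-1 *: P m (X (P n x))]); exists Y.
have GY : G X = Y.
  apply: (op_ext hP) => //; first by case: hG.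
  by move=> m n x _ _; rewrite hY; case: hG => _ ->.
by split=> // [|x|]; rewrite GY.
Qed.

Lemma bounded_Gamma X : bounded_op X -> bounded_op (G X).
Proof. by move=> bX; case: (GammaP bX (opnorm_ge0 bX) (opnormP bX)). Qed.

Lemma proj_Gamma X m n x : bounded_op X -> P m (G X (P n x)) =
  if m == n then 0 else (lam m - lam n)^-1 *: P m (X (P n x)).
Proof. by move=> bX; case: (GammaP bX (opnorm_ge0 bX) (opnormP bX)). Qed.

Lemma GammaB X Y : bounded_op X -> bounded_op Y -> G (X - Y) = G X - G Y.
Proof.
move=> bX bY; have bXY := bounded_opB bX bY.
have bG := bounded_opB (bounded_Gamma bX) (bounded_Gamma bY).
apply: (op_ext hP) => //; first exact: bounded_Gamma.
move=> m n x _ _; have lP := res_lin hP (Logic.I : setT m).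
rewrite proj_Gamma // !fctE !(linB _ _ lP) !proj_Gamma //.
by case: eqP => _; rewrite ?subrr // scalerBr.
Qed.

(** This is how the operator norm bound for Gamma is applied to each block
    separately. *)
Lemma Gamma_block X m n : bounded_op X -> I m -> I n ->
  Q m \o G X \o Q n = G (Q m \o X \o Q n).
Proof.
move=> bX Im In.
have bQ Y : bounded_op Y -> bounded_op (Q m \o Y \o Q n).
  move=> bY; apply: bounded_op_comp (bounded_block_proj n).
  exact: bounded_op_comp (bounded_block_proj m) bY.
apply: (op_ext hP); [exact/bQ/bounded_Gamma|exact/bounded_Gamma/bQ|].
move=> k l x _ _; rewrite proj_Gamma /=; last exact: bQ.
rewrite !proj_block // block_of_proj //.
have lP := res_lin hP (Logic.I : setT k).
case: (blk k == m); last by rewrite scaler0; case: ifP.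
case: ifP => _; first exact: proj_Gamma.
rewrite (lin0 bX.1) (lin0 (bounded_Gamma bX).1) (lin0 lP).
by rewrite scaler0; case: ifP.
Qed.

(** * Square summable block matrices *)

Local Notation block_norm X m n := (opnorm (Q m \o X \o Q n)).

Lemma bounded_block X m n : bounded_op X -> bounded_op (Q m \o X \o Q n).
Proof.
move=> bX; apply: bounded_op_comp (bounded_block_proj n).
exact: bounded_op_comp (bounded_block_proj m) bX.
Qed.

Lemma block_norm_ge0 X m n : bounded_op X -> 0 <= block_norm X m n.
Proof. by move=> bX; apply/opnorm_ge0/bounded_block. Qed.

Lemma block_norm_bound X m n x : bounded_op X ->
  rnorm (Q m (X (Q n x))) <= block_norm X m n * rnorm x.
Proof. by move=> bX; have := opnormP (bounded_block m n bX) x. Qed.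

Lemma block_norm_boundr X m n x : bounded_op X -> I n ->
  rnorm (Q m (X (Q n x))) <= block_norm X m n * rnorm (Q n x).
Proof.
move=> bX In; rewrite -{1}(res_idem resolution_block_proj x In).
exact: block_norm_bound.
Qed.

Lemma block_norm_le X m n c : bounded_op X -> 0 <= c ->
  (forall x, rnorm (Q m (X (Q n x))) <= c * rnorm x) -> block_norm X m n <= c.
Proof. by move=> bX c0 hc; apply: opnorm_le => //; exact: bounded_block. Qed.

(** An upper bound for the norm of S2, see S2normP; it avoids extended
    reals in the estimates. *)
Definition S2_le (X : H -> H) (c : R) :=
  [/\ bounded_op X, 0 <= c &
   forall s : seq (int * int), uniq s -> {in s, forall p, I p.1 /\ I p.2} ->
     \sum_(p <- s) (block_norm X p.1 p.2) ^+ 2 <= c ^+ 2].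

Lemma S2_leI X c (b : int -> int -> R) : bounded_op X -> 0 <= c ->
  (forall m n, I m -> I n -> 0 <= b m n) ->
  (forall m n x, I m -> I n -> rnorm (Q m (X (Q n x))) <= b m n * rnorm x) ->
  (forall s : seq (int * int), uniq s -> {in s, forall p, I p.1 /\ I p.2} ->
     \sum_(p <- s) (b p.1 p.2) ^+ 2 <= c ^+ 2) -> S2_le X c.
Proof.
move=> bX c0 b0 hb hc; split=> // s us sI; apply: le_trans (hc s us sI).
rewrite !big_seq; apply: ler_sum => -[m n] /sI[/= Im In].
by rewrite ler_pXn2r ?nnegrE ?block_norm_ge0 ?b0 // block_norm_le ?b0 // => x; exact: hb.
Qed.

Lemma S2_le_pair X c (s t : seq int) : S2_le X c -> uniq s -> uniq t ->
  {in s, forall n, I n} -> {in t, forall n, I n} ->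
  \sum_(m <- s) \sum_(n <- t) (block_norm X m n) ^+ 2 <= c ^+ 2.
Proof.
move=> [bX c0 hc] us ut sI tI.
have := hc [seq (m, n) | m <- s, n <- t].
rewrite big_allpairs; apply.
  by apply: allpairs_uniq => // -[? ?] [? ?] _ _ [-> ->].
by move=> _ /allpairsP[[m n] /= [ms nt ->]]; split; [exact: sI|exact: tI].
Qed.

Lemma S2_le_widen X c c' : c <= c' -> S2_le X c -> S2_le X c'.
Proof.
move=> cc [bX c0 hc]; have c'0 := le_trans c0 cc; split=> // s us sI.
by apply: le_trans (hc s us sI) _; rewrite ler_pXn2r ?nnegrE.
Qed.

Lemma S2_le0 : S2_le 0 0.
Proof.
apply: (@S2_leI _ _ (fun _ _ => 0)) => // [|m n x _ _|s _ _].
- exact: bounded_op0.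
- by rewrite (lin0 (linear_block_proj m)) rnorm0 mul0r.
- by rewrite big1 // => p _; rewrite expr0n.
Qed.

Lemma S2_leD X Y c d : S2_le X c -> S2_le Y d -> S2_le (X + Y) (c + d).
Proof.
move=> [bX c0 hc] [bY d0 hd].
apply: (@S2_leI _ _ (fun m n => block_norm X m n + block_norm Y m n))
  => [|||m n x Im In|s us sI].
- exact: bounded_opD.
- exact: addr_ge0.
- by move=> m n _ _; rewrite addr_ge0 ?block_norm_ge0.
- rewrite fctE (linD _ _ (linear_block_proj m)) (le_trans (ler_rnormD _ _)) // mulrDl.
  by rewrite lerD // block_norm_bound.
by apply: minkowski_seq => //; [exact: hc|exact: hd].
Qed.

Lemma S2_leN X c : S2_le X c -> S2_le (- X) c.
Proof.
move=> [bX c0 hc]; apply: (@S2_leI _ _ (fun m n => block_norm X m n)) => //.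
- exact: bounded_opN.
- by move=> m n _ _; exact: block_norm_ge0.
- move=> m n x _ _; rewrite fctE (linN _ (linear_block_proj m)) rnormN.
  exact: block_norm_bound.
Qed.

Lemma S2_leB X Y c d : S2_le X c -> S2_le Y d -> S2_le (X - Y) (c + d).
Proof. by move=> hX hY; apply/S2_leD/S2_leN. Qed.

Lemma S2_le_distC X Y c : S2_le (X - Y) c -> S2_le (Y - X) c.
Proof. by move=> /S2_leN; rewrite opprB. Qed.

(** Apply the Cauchy-Schwarz inequality to each row of blocks of X x. *)
Lemma S2_le_op X c x : S2_le X c -> rnorm (X x) <= c * rnorm x.
Proof.
move=> hX; have [bX c0 hc] := hX; have rQ := resolution_block_proj.
apply: (res_norm_le nin rQ) => [|F FI]; first by rewrite mulr_ge0 ?rnorm_ge0.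
apply: sqr_sum_closed => [|e e0]; first by rewrite mulr_ge0 ?rnorm_ge0.
have [m _|F0 [F0I h0]] := @uncond_sum_common _ _ _ (F : seq int) I
   (fun m n => Q m (X (Q n x))) (fun m => Q m (X x)) e e0.
  apply: uncond_sum_lin; first exact: bounded_block_proj.
  by apply: uncond_sum_lin => //; exact: (res_sum rQ).
have {}h0 := h0 F0 (@subset_refl _ _) F0I.
exists (fun m => rnorm (\sum_(n <- F0) Q m (X (Q n x)))).
split=> [m _|m mF|].
- exact: rnorm_ge0.
- rewrite ger0_norm ?rnorm_ge0 //.
  apply: le_trans (ler_rnorm_dist _ (\sum_(n <- F0) Q m (X (Q n x)))) _.
  by rewrite lerD2l rnorm_distC ltW // h0.
apply: (@le_trans _ _ (\sum_(m <- F)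
    (\sum_(n <- F0) block_norm X m n ^+ 2) * rnorm x ^+ 2)).
  rewrite !big_seq; apply: ler_sum => m mF.
  apply: (@le_trans _ _ ((\sum_(n <- F0) block_norm X m n * rnorm (Q n x)) ^+ 2)).
    rewrite ler_pXn2r ?nnegrE ?rnorm_ge0 //; last first.
      by apply: sumr_ge0 => n _; rewrite mulr_ge0 ?rnorm_ge0 ?block_norm_ge0.
    apply: le_trans (ler_rnorm_sum _ _) _; rewrite !big_seq.
    by apply: ler_sum => n /F0I In; apply: block_norm_boundr.
  apply: le_trans (cauchy_schwarz_seq _ _ _) _.
  apply: ler_wpM2l; first exact: sum_sqr_ge0.
  exact: (res_bessel nin rQ).
rewrite -mulr_suml exprMn ler_wpM2r ?sqr_ge0 //.
by apply: S2_le_pair => //; rewrite ?fset_uniq.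
Qed.

(** The balls of S2 are closed in the strong operator topology. Only finitely
    many vectors are involved in a finite square sum: for each block, a vector on
    which its norm is nearly attained. *)
Lemma S2_le_closed Z c : bounded_op Z -> 0 <= c ->
  (forall (xs : seq H) (e : R), 0 < e -> exists Z', S2_le Z' c /\
     {in xs, forall x, rnorm (Z' x - Z x) <= e}) -> S2_le Z c.
Proof.
move=> bZ c0 h; split=> // s us sI.
have test (f : int * int -> H) : (forall p, rnorm (f p) <= 1) ->
    \sum_(p <- s) rnorm (Q p.1 (Z (Q p.2 (f p)))) ^+ 2 <= c ^+ 2.
  move=> f1; apply: sqr_sum_closed => // e e0.
  have [Z' [[bZ' _ hZ'] Z'Z]] := h [seq Q p.2 (f p) | p <- s] e e0.
  exists (fun p => rnorm (Q p.1 (Z' (Q p.2 (f p))))); split=> [p _|p ps|].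
  - exact: rnorm_ge0.
  - rewrite ger0_norm ?rnorm_ge0 //.
    apply: le_trans (ler_rnorm_dist _ (Q p.1 (Z' (Q p.2 (f p))))) _.
    rewrite lerD2l -(linB _ _ (linear_block_proj _)).
    apply: le_trans (res_contr nin resolution_block_proj _ (sI p ps).1) _.
    by rewrite rnorm_distC; apply: Z'Z; apply/mapP; exists p.
  apply: le_trans (hZ' s us sI); apply: ler_sum => p _.
  rewrite ler_pXn2r ?nnegrE ?rnorm_ge0 ?block_norm_ge0 //.
  apply: le_trans (block_norm_bound _ _ _ bZ') _.
  by rewrite -{2}(mulr1 (opnorm _)) ler_wpM2l ?block_norm_ge0.
apply: sqr_sum_closed => // e e0.
have ex p : exists x, rnorm x <= 1 /\
    block_norm Z p.1 p.2 - e < rnorm (Q p.1 (Z (Q p.2 x))).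
  have [|x x1 hx] := @opnorm_adherent _ _ _ (bounded_block p.1 p.2 bZ)
    (block_norm Z p.1 p.2 - e); first by rewrite ltrBlDr ltrDl.
  by exists x.
have [f hf] := choice ex.
exists (fun p => rnorm (Q p.1 (Z (Q p.2 (f p))))); split=> [p _|p _|].
- exact: rnorm_ge0.
- by rewrite ger0_norm ?block_norm_ge0 // -lerBlDr ltW //; case: (hf p).
- by apply: test => p; case: (hf p).
Qed.

(** Insert a partial sum of block projections between X and Y. The blocks of
    the truncated product are finite sums, to which Cauchy-Schwarz applies as for
    the Hilbert-Schmidt norm, and the truncations converge strongly. *)
Lemma S2_leM X Y c d : S2_le X c -> S2_le Y d -> S2_le (X \o Y) (c * d).
Proof.
move=> hX hY; have [bX c0 hc] := hX; have [bY d0 hd] := hY.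
have rQ := resolution_block_proj.
apply: S2_le_closed => [||xs e e0]; rewrite ?mulr_ge0 //.
  exact: bounded_op_comp.
have c1 : 0 < c + 1 by rewrite ltr_wpDl.
have [x _|F [FI hF]] := @uncond_sum_common _ _ _ xs I
   (fun x k => Q k (Y x)) Y _ (divr_gt0 e0 c1).
  exact: (res_sum rQ).
have {}hF := hF F (@subset_refl _ _) FI.
pose S y := \sum_(k <- F) Q k y.
have bS : bounded_op S.
  rewrite /S; elim: (F : seq int) => [|k s IH].
    by under eq_fun do rewrite big_nil; exact: bounded_op0.
  by under eq_fun do rewrite big_cons; exact: (bounded_opD (bounded_block_proj k) IH).
exists (X \o S \o Y); split; last first.
  move=> x xxs /=; rewrite -(linB _ _ bX.1).
  apply: le_trans (S2_le_op _ hX) _.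
  apply: (@le_trans _ _ ((c + 1) * rnorm (S (Y x) - Y x))).
    by rewrite ler_wpM2r ?rnorm_ge0 // lerDl.
  by rewrite mulrC -ler_pdivlMr // ltW // hF.
apply: (@S2_leI _ _ (fun m n => \sum_(k <- F) block_norm X m k * block_norm Y k n)).
- by apply: bounded_op_comp bY; exact: bounded_op_comp.
- exact: mulr_ge0.
- by move=> m n _ _; apply: sumr_ge0 => k _; rewrite mulr_ge0 ?block_norm_ge0.
- move=> m n x Im In /=.
  rewrite /S (lin_sum _ _ bX.1) (lin_sum _ _ (linear_block_proj m)).
  apply: le_trans (ler_rnorm_sum _ _) _; rewrite mulr_suml !big_seq.
  apply: ler_sum => k /FI Ik.
  apply: le_trans (block_norm_boundr _ _ bX Ik) _; rewrite -mulrA.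
  by rewrite ler_wpM2l ?block_norm_ge0 // block_norm_bound.
move=> s us sI.
set s1 := undup [seq p.1 | p <- s]; set s2 := undup [seq p.2 | p <- s].
pose al m := \sum_(k <- F) block_norm X m k ^+ 2.
pose be n := \sum_(k <- F) block_norm Y k n ^+ 2.
have al0 m : 0 <= al m by exact: sum_sqr_ge0.
have be0 n : 0 <= be n by exact: sum_sqr_ge0.
apply: (@le_trans _ _ (\sum_(p <- s) al p.1 * be p.2)).
  by apply: ler_sum => p _; exact: cauchy_schwarz_seq.
apply: (@le_trans _ _ (\sum_(p <- [seq (m, n) | m <- s1, n <- s2]) al p.1 * be p.2)).
  apply: ler_sum_uniq => // [|p ps|p]; last exact: mulr_ge0.
    by apply: allpairs_uniq; rewrite ?undup_uniq // => -[? ?] [? ?] _ _ [-> ->].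
  apply/allpairsP; exists p; split; rewrite ?mem_undup ?map_f //.
  by case: p {ps}.
rewrite big_allpairs /= exprMn.
under eq_bigr do rewrite -mulr_sumr.
rewrite -mulr_suml; apply: ler_pM; rewrite ?sumr_ge0 //.
  apply: S2_le_pair => //; rewrite ?undup_uniq ?fset_uniq //.
  by move=> m; rewrite mem_undup => /mapP[p /sI[I1 _] ->].
rewrite /be exchange_big /=.
apply: S2_le_pair => //; rewrite ?undup_uniq ?fset_uniq //.
by move=> m; rewrite mem_undup => /mapP[p /sI[_ I2] ->].
Qed.

Lemma S2_le_JSigma X c : S2_le X c -> S2_le (J X) c.
Proof.
move=> [bX c0 hc]; apply: (@S2_leI _ _ (fun m n => block_norm X m n)) => //.
- exact: bounded_JSigma.
- by move=> m n _ _; exact: block_norm_ge0.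
move=> m n x Im In; rewrite block_JSigma //.
case: eqP => [->|_]; first exact: block_norm_bound.
by rewrite rnorm0 mulr_ge0 ?block_norm_ge0 ?rnorm_ge0.
Qed.

Lemma block_offdiag X m n x : bounded_op X -> I m -> I n ->
  Q m ((X - J X) (Q n x)) = if m == n then 0 else Q m (X (Q n x)).
Proof.
move=> bX Im In; rewrite !fctE (linB _ _ (linear_block_proj m)) block_JSigma //.
by case: eqP; rewrite ?subr0 ?subrr.
Qed.

Lemma S2_le_offdiag X c : S2_le X c -> S2_le (X - J X) c.
Proof.
move=> [bX c0 hc]; apply: (@S2_leI _ _ (fun m n => block_norm X m n)) => //.
- by apply: bounded_opB => //; exact: bounded_JSigma.
- by move=> m n _ _; exact: block_norm_ge0.
move=> m n x Im In; rewrite block_offdiag //.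
case: eqP => [->|_]; last exact: block_norm_bound.
by rewrite rnorm0 mulr_ge0 ?block_norm_ge0 ?rnorm_ge0.
Qed.

(** On each block Gamma is bounded by gam in the operator norm. *)
Lemma S2_le_Gamma X c : S2_le X c -> S2_le (G X) (gam * c).
Proof.
move=> [bX c0 hc].
apply: (@S2_leI _ _ (fun m n => gam * block_norm X m n)).
- exact: bounded_Gamma.
- exact: mulr_ge0.
- by move=> m n _ _; rewrite mulr_ge0 ?block_norm_ge0.
- move=> m n x Im In.
  have := congr1 (@^~ x) (Gamma_block bX Im In) => /= ->.
  have b0 := block_norm_ge0 m n bX.
  have [_ h _] := GammaP (bounded_block m n bX) b0 (opnormP (bounded_block m n bX)).
  exact: h.
move=> s us sI; under eq_bigr do rewrite exprMn.
by rewrite -mulr_sumr exprMn ler_wpM2l ?sqr_ge0 ?hc.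
Qed.

(** The limit is taken pointwise; that it is also the limit for the norm of
    S2, with the same rate, follows from the closedness of the balls. *)
Lemma S2_complete (X : nat -> H -> H) (C q : R) : 0 <= C -> 0 <= q < 1 ->
  (forall k, bounded_op (X k)) ->
  (forall k, S2_le (X k.+1 - X k) (C * q ^+ k)) ->
  exists2 Y, bounded_op Y & forall k, S2_le (X k - Y) (C / (1 - q) * q ^+ k).
Proof.
move=> C0 q01 bX hX; have /andP[q0 q1] := q01.
have q1' : 0 < 1 - q by rewrite subr_gt0.
set K := C / (1 - q); have K0 : 0 <= K by apply: divr_ge0 => //; exact: ltW.
have CE : C = K * (1 - q) by rewrite /K divfK // gt_eqF.
have KE : C / (1 - q) = K by [].
clearbody K.
have ex x : exists l, forall n, rnorm (X n x - l) <= K * rnorm x * q ^+ n.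
  have [|n|l hl] := @geometric_cvg _ _ (fun n => X n x) (C * rnorm x) q _ q01.
  - by rewrite mulr_ge0 ?rnorm_ge0.
  - by have := S2_le_op x (hX n); rewrite mulrAC.
  by exists l => n; have := hl n; rewrite (mulrAC C) KE.
have [Y hY] := choice ex.
have lY : linear Y.
  move=> a x y; apply: eq_rnorm_small => e e0.
  set K1 := K * rnorm (a *: x + y) + K * rnorm x * rnorm a + K * rnorm y.
  have K10 : 0 <= K1 by rewrite !addr_ge0 ?mulr_ge0 ?rnorm_ge0.
  have [N hN] := expr_small q01 e0 K10; apply: le_lt_trans (hN N (leqnn _)).
  have -> : Y (a *: x + y) - (a *: Y x + Y y) =
     - (X N (a *: x + y) - Y (a *: x + y)) +
     (a *: (X N x - Y x) + (X N y - Y y)).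
    rewrite (bX N).1 scalerBr.
    move: (a *: X N x) (X N y) (a *: Y x) (Y y) (Y _) => u v u' v' w.
    by rewrite opprB [u - u' + _]addrACA -opprD subrKA.
  apply: le_trans (ler_rnormD _ _) _; rewrite rnormN /K1 -addrA mulrDl.
  apply: lerD (hY _ _) _; rewrite mulrDl; apply: le_trans (ler_rnormD _ _) _.
  apply: lerD (hY _ _); rewrite rnormZ (mulrC _ (rnorm a)) -mulrA.
  by apply: ler_wpM2l (hY _ _); exact: rnorm_ge0.
have bY : bounded_op Y.
  have /bounded_opP[_ [c c0 hc]] := bX 0%N.
  apply: (@bounded_opI _ _ _ (c + K)) => // [|x]; first exact: addr_ge0.
  apply: le_trans (ler_rnorm_dist _ (X 0%N x)) _; rewrite mulrDl.
  by apply: lerD => //; rewrite rnorm_distC; have := hY x 0%N; rewrite expr0 mulr1.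
exists Y => // k.
have step n : S2_le (X k - X (k + n)%N) (K * q ^+ k * (1 - q ^+ n)).
  elim: n => [|n IH].
    by rewrite addn0 subrr expr0 subrr mulr0; exact: S2_le0.
  rewrite addnS -(subrKA (X (k + n)%N)).
  have -> : K * q ^+ k * (1 - q ^+ n.+1) =
      K * q ^+ k * (1 - q ^+ n) + C * q ^+ (k + n).
    by rewrite CE exprD exprS; ring.
  by apply: S2_leD => //; apply: S2_le_distC.
apply: S2_le_closed => [||xs e e0].
- exact: bounded_opB.
- by apply: mulr_ge0 => //; exact: exprn_ge0.
pose M := \sum_(x <- xs) rnorm x.
have M0 : 0 <= M by apply: sumr_ge0 => x _; exact: rnorm_ge0.
have [N hN] := expr_small q01 e0 (mulr_ge0 K0 M0).
exists (X k - X (k + N)%N); split.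
  apply: S2_le_widen (step N).
  rewrite -[leRHS]mulr1; apply: ler_wpM2l.
    by apply: mulr_ge0 => //; exact: exprn_ge0.
  by rewrite lerBlDr lerDl exprn_ge0.
move=> x xxs; rewrite !fctE.
have -> : X k x - X (k + N)%N x - (X k x - Y x) = - (X (k + N)%N x - Y x).
  by rewrite !opprB addrC subrKA.
rewrite rnormN; apply: le_trans (hY _ _) _.
apply: le_trans (ltW (hN (k + N)%N (leq_addl _ _))).
apply: ler_wpM2r; first exact: exprn_ge0.
apply: ler_wpM2l => //; rewrite /M (big_rem x) //= lerDl.
by apply: sumr_ge0 => y _; exact: rnorm_ge0.
Qed.

(** The double series is the supremum of its finite partial sums, which are
    what S2_le bounds. *)
Lemma S2normP X c : bounded_op X -> 0 <= c ->
  (S2norm P lam I sigma X <= c%:E)%E <-> S2_le X c.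
Proof.
move=> bX c0; rewrite /S2norm.
set f := fun p : int * int => ((opnorm (Q p.1 \o X \o Q p.2)) ^+ 2)%:E.
have f0 p : (0 <= f p)%E by rewrite lee_fin sqr_ge0.
rewrite poweR12_sqrt; last by apply: esum_ge0 => p _; exact: f0.
have -> : c%:E = sqrte (c ^+ 2)%:E by rewrite /= sqrtr_sqr ger0_norm.
rewrite lee_sqrt ?lee_fin ?sqr_ge0 //; split=> [h|[_ _ h]].
  split=> // s us sI; rewrite -lee_fin; apply: le_trans h.
  apply: esum_ge; exists [set` s].
    by split; [exact: finite_seq|move=> p /= /sI[]].
  by rewrite -fsbig_seq // -sumEFin.
apply: ge_ereal_sup => _ [A [fA AI] <-].
rewrite fsbig_finite // /f sumEFin lee_fin; apply: h; first exact: fset_uniq.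
by move=> p; rewrite in_fset_set // inE => /AI[].
Qed.

Local Notation GS := (GammaSigma P lam I sigma).

Lemma JSigmaB X Y : bounded_op X -> bounded_op Y -> J (X - Y) = J X - J Y.
Proof.
move=> bX bY; have bXY := bounded_opB bX bY.
apply: (op_ext resolution_block_proj); first exact: bounded_JSigma.
  by apply: bounded_opB; exact: bounded_JSigma.
move=> m n x Im In; rewrite block_JSigma // !fctE.
rewrite !(linB _ _ (linear_block_proj m)) !block_JSigma //.
by case: eqP => _; rewrite ?subrr.
Qed.

Lemma bounded_offdiag X : bounded_op X -> bounded_op (X - J X).
Proof. by move=> bX; apply: bounded_opB => //; exact: bounded_JSigma. Qed.

Lemma bounded_GammaSigma X : bounded_op X -> bounded_op (GS X).
Proof. by move=> bX; apply/bounded_Gamma/bounded_offdiag. Qed.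

Lemma GammaSigmaB X Y : bounded_op X -> bounded_op Y -> GS (X - Y) = GS X - GS Y.
Proof.
move=> bX bY; rewrite /GammaSigma JSigmaB // -GammaB; try exact: bounded_offdiag.
congr (Gamma _ _ _); rewrite !opprB addrACA [RHS]addrACA.
by congr (_ + _); exact: addrC.
Qed.

Lemma S2_le_GammaSigma X c : S2_le X c -> S2_le (GS X) (gam * c).
Proof. by move=> hX; apply/S2_le_Gamma/S2_le_offdiag. Qed.

Lemma block_GammaSigma_diag X n x : bounded_op X -> I n -> Q n (GS X (Q n x)) = 0.
Proof.
move=> bX In; have bO := bounded_offdiag bX.
have := congr1 (@^~ x) (Gamma_block bO In In) => /= ->.
have -> : Q n \o (X - J X) \o Q n = 0.
  by apply/funext => y /=; rewrite block_offdiag // eqxx.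
have := S2_le_op x (S2_le_Gamma S2_le0); rewrite mulr0 mul0r.
by move=> h; apply/eqP; rewrite -rnorm_eq0 eq_le h rnorm_ge0.
Qed.

Lemma JSigma_comm X n x : bounded_op X -> I n -> J X (Q n x) = Q n (J X x).
Proof.
move=> bX In; have bJ := bounded_JSigma bX.
have JQb := bounded_op_comp bJ (bounded_block_proj n).
have QJb := bounded_op_comp (bounded_block_proj n) bJ.
have := op_ext resolution_block_proj JQb QJb.
move=> /(_ _)/(congr1 (@^~ x)); apply => m k y Im Ik /=.
rewrite comp_block // [in RHS]comp_block //.
have [<-|nk] := eqVneq n k.
  by rewrite block_JSigma //; case: eqP.
rewrite (lin0 bJ.1) (lin0 (linear_block_proj m)) block_JSigma //.
case: eqP => // ->; by rewrite (negPf nk).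
Qed.

Lemma S2_le_lim X c : 0 <= c -> (forall e, 0 < e -> S2_le X (c + e)) -> S2_le X c.
Proof.
move=> c0 h; have [bX _ _] := h 1 ltr01; apply/S2normP => //.
apply/lee_addgt0Pr => e e0; rewrite -EFinD; apply/S2normP => //; last exact: h.
by rewrite addr_ge0 // ltW.
Qed.

Lemma S2_le0_eq X Y : S2_le (X - Y) 0 -> X = Y.
Proof.
move=> h; apply/funext => x; apply/eqP; rewrite -subr_eq0 -rnorm_eq0.
by have := S2_le_op x h; rewrite mul0r eq_le rnorm_ge0 andbT.
Qed.

Lemma S2_le_S2 X c : S2_le X c -> S2 P lam I sigma X.
Proof.
move=> hX; have [bX c0 _] := hX; split=> //.
by move/S2normP : hX => /(_ bX c0)/le_lt_trans; apply; exact: ltry.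
Qed.

(** * The fixed point of Phi *)

Variables (B : H -> H) (beta : R).
Hypothesis hB : S2_le B beta.
Hypothesis gamp : 0 < gam.
Hypothesis small : 3 * beta * gam < 1.

Local Notation F := (Phi P lam I sigma B).
Let bB : bounded_op B. Proof. by case: hB. Qed.
Let beta0 : 0 <= beta. Proof. by case: hB. Qed.
Local Notation q := (3 * beta * gam).

Let q01 : 0 <= q < 1. Proof. by rewrite small andbT !mulr_ge0. Qed.

(** On the ball of radius 1/gam the operator U = Gamma X has norm at most 1,
    so each of the three summands of Phi X has norm at most beta. *)
Lemma Phi_le X : S2_le X gam^-1 -> S2_le (F X) (3 * beta).
Proof.
move=> hX; have hU := S2_le_GammaSigma hX; rewrite divff ?gt_eqF // in hU.
have hBU := S2_leM hB hU; have hUV := S2_leM hU (S2_le_JSigma hBU).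
by have := S2_leD (S2_leB hBU hUV) hB; apply: S2_le_widen; lra.
Qed.

Lemma Phi_ball X : S2_le X gam^-1 -> S2_le (F X) gam^-1.
Proof.
move=> /Phi_le; apply: S2_le_widen.
by rewrite -[leRHS]mul1r ler_pdivlMr // ltW.
Qed.

(** The three terms of increment_formula contribute beta gam d each. *)
Lemma Phi_contraction X Y d : S2_le X gam^-1 -> S2_le Y gam^-1 ->
  S2_le (X - Y) d -> S2_le (F X - F Y) (q * d).
Proof.
move=> hX hY hXY; have [bX _ _] := hX; have [bY _ _] := hY.
have bUX := bounded_GammaSigma bX; have bUY := bounded_GammaSigma bY.
have bXY := bounded_opB bX bY.
have hUX := S2_le_GammaSigma hX; have hUY := S2_le_GammaSigma hY.
rewrite divff ?gt_eqF // in hUX hUY.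
have hU := S2_le_GammaSigma hXY.
have E := increment_formula (GS X) (J (B \o GS X)) (J (B \o GS Y)) bB.1 bUY.1.
have EB : (B \o GS X) - (B \o GS Y) = B \o GS (X - Y).
  rewrite (GammaSigmaB bX bY); apply/funext => x.
  by rewrite [RHS](linB _ _ bB.1).
have bBU := bounded_op_comp bB bUX; have bBU' := bounded_op_comp bB bUY.
rewrite -(GammaSigmaB bX bY) -(JSigmaB bBU bBU') EB in E.
suff : S2_le (B \o GS (X - Y) - (GS (X - Y) \o J (B \o GS X) +
    (GS Y \o J (B \o GS (X - Y))))) (q * d) by rewrite -E.
have h1 := S2_leM hB hU.
have h2 := S2_leM hU (S2_le_JSigma (S2_leM hB hUX)).
have h3 := S2_leM hUY (S2_le_JSigma h1).
have := S2_leB h1 (S2_leD h2 h3); apply: S2_le_widen.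
by rewrite le_eqVlt; apply/orP; left; apply/eqP; ring.
Qed.

Let X k := iter k F 0.

Let X_ball k : S2_le (X k) gam^-1.
Proof.
elim: k => [|k IH]; last exact: Phi_ball.
by apply: S2_le_widen S2_le0; rewrite invr_ge0.
Qed.

Let bX k : bounded_op (X k). Proof. by case: (X_ball k). Qed.

Let X_step k : S2_le (X k.+1 - X k) (gam^-1 * q ^+ k).
Proof.
elim: k => [|k IH]; first by rewrite /= subr0 mulr1; exact: (X_ball 1).
have := Phi_contraction (X_ball k.+1) (X_ball k) IH; apply: S2_le_widen.
by rewrite exprS mulrCA.
Qed.

Lemma iterates_converge : exists Xs, S2_limit P lam I sigma X Xs.
Proof.
have i0 : 0 <= gam^-1 by rewrite invr_ge0.
have [Y bY hY] := S2_complete i0 q01 bX X_step.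
set K := gam^-1 / (1 - q) in hY.
have K0 : 0 <= K by have := (hY 0%N); rewrite expr0 mulr1 => -[].
exists Y; split=> [k||].
- exact: S2_le_S2 (X_ball k).
- have := S2_leN (hY 0%N); rewrite sub0r opprK; exact: S2_le_S2.
have Kc : (fun k => (K * q ^+ k)%:E) @ \oo --> 0%E.
  apply: cvg_EFin; first by near=> n.
  have -> : (0 : R) = K * 0 by rewrite mulr0.
  apply: cvgM; first exact: cvg_cst.
  by apply: cvg_expr; have /andP[? ?] := q01; rewrite ger0_norm.
apply: squeeze_cvge Kc; last exact: cvg_cst.
near=> k; rewrite poweR_ge0 /=; apply/S2normP; last exact: hY.
- by apply: bounded_opB.
- by case: (hY k).
Unshelve. all: by end_near. Qed.

(** Two successive iterates are needed at once, to pass to the limit in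
    X (k + 1) = Phi (X k). *)
Lemma S2_limitP Xs e : S2_limit P lam I sigma X Xs -> 0 < e ->
  exists k, S2_le (X k - Xs) e /\ S2_le (X k.+1 - Xs) e.
Proof.
move=> [_ [bXs _] /fine_cvgP[fin /cvgrPdist_lt/(_ e)]] h e0.
have {}h := h e0.
have [N _ hN] : \forall k \near \oo, S2_le (X k - Xs) e.
  near=> k.
  have fk : S2norm P lam I sigma (X k - Xs) \is a fin_num by near: k.
  have : `|0 - fine (S2norm P lam I sigma (X k - Xs))| < e by near: k.
  rewrite sub0r normrN => hk; apply/S2normP; [exact: bounded_opB|exact: ltW|].
  rewrite -(fineK fk) lee_fin; apply/ltW/le_lt_trans/hk/ler_norm.
by exists N; split; apply: hN => /=.
Unshelve. all: by end_near. Qed.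

Lemma limit_fixed Xs : S2_limit P lam I sigma X Xs ->
  S2_le Xs gam^-1 /\ F Xs = Xs.
Proof.
move=> hl.
have hXs : S2_le Xs gam^-1.
  apply: S2_le_lim; first by rewrite invr_ge0.
  move=> e e0; have [k [hk _]] := S2_limitP hl e0.
  have -> : Xs = X k - (X k - Xs) by rewrite opprB addrC subrK.
  exact: S2_leB.
split=> //; apply: S2_le0_eq; apply: S2_le_lim => // e e0; rewrite add0r.
have e20 : 0 < e / 2 by rewrite divr_gt0.
have [k [hk hk1]] := S2_limitP hl e20.
have h := Phi_contraction hXs (X_ball k) (S2_le_distC hk).
rewrite -(subrKA (F (X k))); have := S2_leD h hk1; apply: S2_le_widen.
by have /andP[? ?] := q01; nra.
Qed.

(** The radius 3 beta, smaller than 1/gam, is what makes gam |X| < 1. *)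
Lemma limit_le Xs : S2_limit P lam I sigma X Xs -> S2_le Xs (3 * beta).
Proof. by move=> /limit_fixed[h <-]; exact: Phi_le. Qed.

(** J kills B, and it kills U V because the diagonal blocks of U vanish and
    V is block diagonal. *)
Lemma limit_diag Xs : S2_limit P lam I sigma X Xs -> J B = 0 ->
  J Xs = J (B \o GS Xs).
Proof.
move=> /limit_fixed[hX FX] JB0; have [bXs _ _] := hX; have bU := bounded_GammaSigma bXs.
have bBU := bounded_op_comp bB bU.
apply: (op_ext resolution_block_proj); [exact: bounded_JSigma..|].
move=> m n x Im In; rewrite !block_JSigma //; case: eqP => // ->.
have lQ := linear_block_proj n.
rewrite -{1}FX /Phi !fctE /= (linD _ _ lQ) (linB _ _ lQ).
rewrite JSigma_comm // -(res_idem resolution_block_proj (J _ x) In).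
rewrite -JSigma_comm // block_GammaSigma_diag // subr0.
have : Q n (J B (Q n x)) = 0 by rewrite JB0 (lin0 (linear_block_proj n)).
by rewrite block_JSigma // eqxx => ->; rewrite addr0.
Qed.

(** * The unperturbed operator in coordinates *)

Variable (A : operator H).
Hypothesis lA : linear_operator A.
Hypothesis cA : closed_operator A.
Hypothesis nA : normal inner A.
Hypothesis hPA : forall n x, dom A (P n x) /\ A (P n x) = lam n *: P n x.

Hypothesis lam_inj : forall m n, lam m = lam n -> m = n.

Let lP n : linear (P n). Proof. exact: (res_lin hP). Qed.

(** A normal operator has the same eigenvectors as its adjoint. For y in the
    range of P n and a = A^* y, normality gives |a| = |A y|, and expanding
    |a - c y|^2 with c the conjugate of lam n yields 0. Moving A to the other side
    of the inner product then gives the row of A. *)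
Lemma normal_eigenrow n x : dom A x -> P n (A x) = lam n *: P n x.
Proof.
move=> dx; apply: inner_inj => // w; pose y := P n w.
have [domE normE] := nA.
have dy : dom A y by case: (hPA n w).
have Ay : A y = lam n *: y by case: (hPA n w).
pose a := adjoint inner A y.
have ha v : dom A v -> inner (A v) y = inner v a.
  have : dom (adjoint inner A) y by rewrite domE.
  by move=> /(@xgetPex _ 0); apply.
pose c := (lam n)^*.
have yy : (inner y y)^* = inner y y by rewrite -inner_conj.
have aa : inner a a = lam n * (c * inner y y).
  have -> : inner a a = inner (A y) (A y).
    by rewrite !(inner_norm nin) /rnorm (normE y dy).
  by rewrite Ay linearZl_LR linearZr_LR.
have ya : inner y a = lam n * inner y y by rewrite -ha // Ay linearZl_LR.
have ay : inner a y = c * inner y y by rewrite inner_conj ya rmorphM /= yy.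
have aE : a = c *: y.
  apply/eqP; rewrite -subr_eq0 -rnorm_eq0 -(sqrf_eq0 (rnorm _)).
  have : inner (a - c *: y) (a - c *: y) = 0.
    rewrite linearBl /= !linearBr /= !linearZl_LR !linearZr_LR /=.
    by rewrite aa ay ya /c conjCK -[lam n *: _]/(lam n * _); ring.
  by rewrite inner_norm // => -[->].
rewrite (res_adj hP) // ha // aE linearZr_LR /= /c conjCK /y.
by rewrite linearZl_LR /= (res_adj hP).
Qed.

(** A finite partial sum of x is in the domain and its image is the partial sum
    of z; conclude since A is closed. *)
Lemma dom_coord x z : (forall m, P m z = lam m *: P m x) -> dom A x /\ A x = z.
Proof.
move=> h.
suff : [set p : H * H | dom A p.1 /\ p.2 = A p.1] (x, z) by move=> [/= ? ->].
apply: cA => N /nbhs_ballP[eps /= eps0 epsN].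
have e0 : 0 < complex.Re eps by move: eps0; rewrite ltcE => /andP[].
have epsE : eps = Complex (complex.Re eps) 0.
  by move: eps0; rewrite ltcE => /andP[/eqP + _]; case: (eps) => a b /= ->.
pose f (b : bool) n := if b then P n x else P n z.
have [b _|F0 [_ hF]] := @uncond_sum_common _ _ _ [:: true; false] setT f
    (fun b => if b then x else z) _ e0.
  by case: b; exact: (res_sum hP).
have {}hF := hF F0 (@subset_refl _ _) (@subsetT _ _).
have A0 : A 0 = 0.
  by have [d0 /(_ (-1) 0 0 d0 d0)[_]] := lA; rewrite scaler0 addr0 scaleN1r addNr.
have [d e] : dom A (\sum_(n <- F0) P n x) /\
    A (\sum_(n <- F0) P n x) = \sum_(n <- F0) P n z.
  elim: (F0 : seq int) => [|n s [ds es]]; first by rewrite !big_nil; split=> //; case: lA.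
  rewrite !big_cons; have [dn en] := hPA n x.
  by have [? ->] := linear_operatorD lA dn ds; rewrite en es h.
exists (\sum_(n <- F0) P n x, \sum_(n <- F0) P n z); split=> //.
apply: epsN; split=> /=; rewrite -ball_normE /= epsE -rnorm_ltP rnorm_distC.
  exact: (hF true).
exact: (hF false).
Qed.

Lemma block_reduces n : I n -> reduces A (Q n).
Proof.
move=> In x dx; apply: dom_coord => m; rewrite !proj_block //.
by case: ifP; rewrite ?scaler0 // normal_eigenrow.
Qed.

(** Compare the coordinates: at (m, n), the identity reads
    lam m u = lam n u + z for u = z / (lam m - lam n). On the diagonal it requires
    the vanishing of P n Z P n. *)
Lemma Gamma_commutator Z x : bounded_op Z -> (forall n y, P n (Z (P n y)) = 0) ->
  dom A x -> dom A (G Z x) /\ A (G Z x) = G Z (A x) + Z x.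
Proof.
move=> bZ Z0 dx; apply: dom_coord => m.
have bG := bounded_Gamma bZ.
have bPm := res_bounded hP (Logic.I : setT m).
have h1 := uncond_sum_lin bPm (uncond_sum_lin bG (res_sum hP (A x))).
have h2 := uncond_sum_lin bPm (uncond_sum_lin bZ (res_sum hP x)).
have h3 := uncond_sum_lin (bounded_opZ (lam m) bPm) (uncond_sum_lin bG (res_sum hP x)).
rewrite (linD _ _ (lP m)).
apply: uncond_sum_unique (uncond_sumD h1 h2) _.
apply: uncond_sum_ext h3 => n _ /=.
rewrite normal_eigenrow // (linZ _ _ bG.1) (linZ _ _ (lP m)) !proj_Gamma //.
have [->|mn] := eqVneq m n; first by rewrite !scaler0 Z0 addr0.
have ml : lam m != lam n by apply: contraNneq mn => /lam_inj ->.
rewrite !scalerA -[X in _ = _ + X]scale1r -scalerDl; congr (_ *: _).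
by field; rewrite subr_eq0.
Qed.

(** A single term of the sum defining eta already bounds the gap from below. *)
Lemma lam_gap m n : m <> n -> 1 <= gam * rnorm (lam m - lam n).
Proof.
move=> mn.
have d0 : 0 < rnorm (lam m - lam n).
  by rewrite rnorm_gt0 subr_eq0; apply/eqP => /lam_inj.
have := @gapP n [fset m]%fset; rewrite big_seq_fset1 => /(_ _).
rewrite ler_pXn2r ?nnegrE ?invr_ge0 ?rnorm_ge0 // => h.
by rewrite -ler_pdivrMr // mul1r h // inE; apply/eqP => nm; apply: mn.
Qed.

(** Otherwise two eigenvalues of different blocks would both be closer than
    1/(2 gam) to z, hence closer than 1/gam to each other. *)
Lemma gap_dichotomy z n :
  (forall k, blk k == n -> (2 * gam)^-1 <= rnorm (lam k - z)) \/
  (forall k, blk k != n -> (2 * gam)^-1 <= rnorm (lam k - z)).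
Proof.
have [|/existsNP[k /not_implyP[kn /negP]]] := pselect (forall k,
  blk k == n -> (2 * gam)^-1 <= rnorm (lam k - z)); first by left.
rewrite -ltNge => kz; right=> j jn; rewrite leNgt; apply/negP => jz.
have jk : j <> k by move=> jk; rewrite jk kn in jn.
have := lam_gap jk; apply/negP; rewrite -ltNge.
have : rnorm (lam j - lam k) < gam^-1.
  have -> : lam j - lam k = (lam j - z) - (lam k - z) by rewrite opprB subrKA.
  apply: le_lt_trans (ler_rnormB _ _) _.
  have -> : gam^-1 = (2 * gam)^-1 + (2 * gam)^-1 by field; rewrite gt_eqF.
  exact: ltrD.
by rewrite -(ltr_pM2l gamp) divff // gt_eqF.
Qed.

(** The resolvent of A on the range of E is diagonal and has norm at most
    1/delta; the perturbation lemma applies with the ratio v/delta. *)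
Lemma far_resolvent (b : pred int) E V z delta v :
  bounded_op E -> (forall k x, P k (E x) = if b k then P k x else 0) ->
  bounded_op V -> V \o E = E \o V -> (forall x, rnorm (V x) <= v * rnorm x) ->
  0 <= v < delta -> (forall k, b k -> delta <= rnorm (lam k - z)) ->
  exists S, is_resolvent_on (op_sub A V) [set x | E x = x] z S.
Proof.
move=> bE PE bV VE hV /andP[v0 vd] far; have d0 := le_lt_trans v0 vd.
pose S := diag_op P [set k | b k] (fun k => (lam k - z)^-1).
have di0 : 0 <= delta^-1 by rewrite invr_ge0 ltW.
have [k /= bk|bS nS _ hS] :=
    diag_opP (d := fun k => (lam k - z)^-1) nin hP (@subsetT _ [set k | b k]) di0.
  by rewrite rnormV lef_pV2 ?posrE ?far // (lt_le_trans d0) // far.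
have PS k x : P k (S x) = if b k then (lam k - z)^-1 *: P k x else 0.
  rewrite /S hS //; case: ifP => [/[!inE] /= -> //|kb].
  by rewrite ifF //; apply/negP => bk; move: kb; rewrite mem_set.
have lz k : b k -> lam k - z != 0.
  by move=> bk; rewrite -rnorm_eq0 gt_eqF // (lt_le_trans d0) // far.
apply: (@resolvent_perturb _ _ _ _ _ _ S (v / delta) lA bE bV) => //.
- split=> // [y /= Ey|x /= Ex dx].
    split=> /=; first by apply: (res_inj hP) => k _; rewrite PE PS; case: (b k).
      suff : dom A (S y) /\ A (S y) = y + z *: S y by case.
      apply: dom_coord => k; rewrite (linD _ _ (lP k)) (linZ _ _ (lP k)) !PS.
      case: ifP => bk; last by rewrite -Ey PE bk !scaler0 addr0.
      rewrite !scalerA -[X in X + _ = _]scale1r -scalerDl; congr (_ *: _).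
      by field; exact: lz.
    suff : dom A (S y) /\ A (S y) = y + z *: S y by case=> _ ->; rewrite addrK.
    apply: dom_coord => k; rewrite (linD _ _ (lP k)) (linZ _ _ (lP k)) !PS.
    case: ifP => bk; last by rewrite -Ey PE bk !scaler0 addr0.
    rewrite !scalerA -[X in X + _ = _]scale1r -scalerDl; congr (_ *: _).
    by field; exact: lz.
  apply: (res_inj hP) => k _; rewrite PS (linB _ _ (lP k)) (linZ _ _ (lP k)).
  case: ifP => bk; last by rewrite -Ex PE bk.
  rewrite normal_eigenrow // -scalerBl scalerA mulVf ?scale1r //; exact: lz.
- by apply/funext => x /=; apply: (res_inj hP) => k _; rewrite PE !PS PE; case: (b k).
- by rewrite divr_ge0 ?(ltW d0) //= ltr_pdivrMr // mul1r.
by move=> x; apply: le_trans (hV _) _; rewrite -mulrA ler_wpM2l.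
Qed.

Hypothesis hA5 : forall e : R, 0 < e ->
    exists2 z, resolvent_set A z & opnorm (resolvent A z) < e.

(** At a point where the resolvent of A has norm less than 1 / (2 (v + 1)),
    perturbations of norm v leave the operator invertible. *)
Lemma perturbed_resolvent_exists V V' v : bounded_op V -> bounded_op V' -> 0 <= v ->
  (forall x, rnorm (V x) <= v * rnorm x) ->
  (forall x, rnorm (V' x) <= v * rnorm x) ->
  exists z, (exists S, is_resolvent_on (op_sub A V) setT z S) /\
    (exists S, is_resolvent_on (op_sub A V') setT z S).
Proof.
move=> bV bV' v0 hV hV'; have v1 : 0 < v + 1 by rewrite ltr_wpDl.
have vi : 0 < (2 * (v + 1))^-1 by rewrite invr_gt0 mulr_gt0.
have [z zA small_z] := hA5 vi; exists z; move/contrapT : zA => exS.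
have hS : is_resolvent_on A setT z (resolvent A z).
  exact: (@xgetPex _ 0 [set S | is_resolvent_on A setT z S]).
have bS : bounded_op (resolvent A z) by case: hS.
have eT : [set x : H | id x = x] = setT by apply/seteqP; split.
have main V0 : bounded_op V0 -> (forall x, rnorm (V0 x) <= v * rnorm x) ->
    exists S, is_resolvent_on (op_sub A V0) setT z S.
  move=> bV0 hV0; rewrite -eT.
  apply: (@resolvent_perturb _ _ A id V0 z (resolvent A z) 2^-1) => //.
  - exact: bounded_op_id.
  - by rewrite eT.
  - by rewrite invr_ge0 ler0n /= invf_lt1 // ltr1n.
  move=> x; apply: le_trans (hV0 _) _.
  apply: (@le_trans _ _ (v * ((2 * (v + 1))^-1 * rnorm x))).
    apply: ler_wpM2l => //; apply: le_trans (opnormP bS x) _.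
    by rewrite ler_wpM2r ?rnorm_ge0 // ltW.
  rewrite mulrA ler_wpM2r ?rnorm_ge0 // ler_pdivrMr ?mulr_gt0 //.
  by rewrite mulrA mulVf ?mul1r ?lerDl // pnatr_eq0.
by split; exact: main.
Qed.

(** * The similarity and the spectral projections *)

Variable Xs : H -> H.
Hypothesis Xs_lim : S2_limit P lam I sigma X Xs.
Hypothesis JB0 : J B = 0.

Local Notation U := (GS Xs).
Local Notation V := (J Xs).
Local Notation W := (id + U).

Let bXs : bounded_op Xs. Proof. by case: (limit_fixed Xs_lim) => -[]. Qed.

Let hU : S2_le U q.
Proof.
have := S2_le_GammaSigma (limit_le Xs_lim); apply: S2_le_widen.
by rewrite mulrC.
Qed.

Let bU : bounded_op U. Proof. by case: hU. Qed.

Let hV : S2_le V beta.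
Proof.
rewrite (limit_diag Xs_lim JB0); have [hX _] := limit_fixed Xs_lim.
have := S2_le_JSigma (S2_leM hB (S2_le_GammaSigma hX)); apply: S2_le_widen.
by rewrite divff ?mulr1 // gt_eqF.
Qed.

Let bV : bounded_op V. Proof. by case: hV. Qed.

Lemma limit_transform_invertible : invertible W.
Proof. by apply: (neumann bU q01) => x; exact: S2_le_op. Qed.

Let bW : bounded_op W. Proof. by case: limit_transform_invertible. Qed.

Lemma limit_intertwines x : dom A x ->
  dom A (W x) /\ A (W x) - B (W x) = W (A x - V x).
Proof.
move=> dx; have bZ := bounded_offdiag bXs.
have Z0 n y : P n ((Xs - V) (P n y)) = 0.
  have In := blkI n.
  have PQn : forall u, P n (Q (blk n) u) = P n u by move=> u; rewrite proj_block // eqxx.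
  have QPn : Q (blk n) (P n y) = P n y by rewrite block_of_proj // eqxx.
  by rewrite -QPn -PQn block_offdiag // eqxx (lin0 (lP n)).
have [dU AU] := Gamma_commutator bZ Z0 dx.
have [dW AW] := linear_operatorD lA dx dU.
split=> //; rewrite {1}/GRing.add /= in AW *.
have -> : A (W x) = A x + A (U x) by exact: AW.
rewrite AU.
have FX : Xs x = B (U x) - U (V x) + B x.
  have [_ {1}<-] := limit_fixed Xs_lim.
  by rewrite (limit_diag Xs_lim JB0).
have -> : (Xs - V) x = B (U x) - U (V x) + B x - V x by rewrite -FX.
have -> : B (W x) = B x + B (U x) by exact: (linD _ _ bB.1).
have -> : W (A x - V x) = A x - V x + (U (A x) - U (V x)).
  by rewrite -(linB _ _ bU.1).
exact: intertwining_algebra.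
Qed.

(** The inclusion of dom A in its image under W uses a common point z of the
    resolvent sets. For y in dom A and h = (A - B - z) y, the vector
    x = (A - V - z)^-1 W^-1 h satisfies (A - B - z) W x = h, hence W x = y. *)
Lemma limit_similarity : similarity (op_sub A B) (op_sub A V) W.
Proof.
have iW := limit_transform_invertible; have [bW' W1 W2] := opinvP iW.
split=> // [|x dx]; last by case: (limit_intertwines dx).
apply/seteqP; split=> [_ [x dx <-]|y dy]; first by case: (limit_intertwines dx).
have b30 : 0 <= 3 * beta by rewrite mulr_ge0.
have b13 : beta <= 3 * beta by rewrite ler_peMl // ler1n.
have bnd Z : S2_le Z beta -> forall x, rnorm (Z x) <= 3 * beta * rnorm x.
  by move=> hZ x; apply: le_trans (S2_le_op x hZ) _; rewrite ler_wpM2r ?rnorm_ge0.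
have [z [[S1 [_ _ hS1]] [S2 [_ hS2 _]]]] :=
  perturbed_resolvent_exists bB bV b30 (bnd _ hB) (bnd _ hV).
set h := A y - B y - z *: y.
have [_ /= dx Ex] := hS2 (opinv W h) Logic.I; set x := S2 _ in dx Ex.
have [dWx WE] := limit_intertwines dx.
have E : A (W x) - B (W x) - z *: W x = h.
  by rewrite WE -(linZ _ _ bW.1) -(linB _ _ bW.1) Ex W1.
exists x => //.
by have := hS1 (W x) Logic.I dWx; rewrite /= E => <-; exact: hS1.
Qed.

Lemma limit_reduces n : I n -> reduces (op_sub A V) (Q n).
Proof.
move=> In x /= dx; have [d ->] := block_reduces In dx; split=> //.
by rewrite JSigma_comm // -(linB _ _ (linear_block_proj n)).
Qed.

(** Apply far_resolvent on the part whose eigenvalues stay away from z: they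
    do so by at least 1/(2 gam), while |V| < 1/(3 gam). *)
Lemma limit_spectra_disjoint n z : I n ->
  (exists S, is_resolvent_on (op_sub A V) [set x | Q n x = x] z S) \/
  (exists S, is_resolvent_on (op_sub A V) [set x | Q n x = 0] z S).
Proof.
move=> In; have bd : 0 <= beta < (2 * gam)^-1.
  rewrite beta0 /= -[ltRHS]mul1r ltr_pdivlMr ?mulr_gt0 //.
  by apply: le_lt_trans small; have := mulr_ge0 beta0 gam0; lra.
have nV x : rnorm (V x) <= beta * rnorm x by exact: S2_le_op.
have [far|far] := gap_dichotomy z n.
  left; apply: (@far_resolvent (fun k => blk k == n) (Q n) V z _ beta) bd far => //.
  - exact: bounded_block_proj.
  - by move=> k x; exact: proj_block.
  by apply/funext => x /=; exact: JSigma_comm.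
right; have -> : [set x | Q n x = 0] = [set x | (id - Q n) x = x].
  apply/seteqP; split=> x /=; rewrite !fctE.
    by move=> ->; rewrite subr0.
  by move=> /eqP; rewrite subr_eq -{1}(addr0 x) => /eqP/addrI <-.
apply: (@far_resolvent (fun k => blk k != n) _ V z _ beta) bd far => //.
- by apply: bounded_opB (bounded_block_proj n); exact: bounded_op_id.
- move=> k x; rewrite !fctE (linB _ _ (lP k)) proj_block //.
  by case: eqP => _; rewrite ?subrr ?subr0.
by apply/funext => x; rewrite /= !fctE (linB _ _ bV.1) JSigma_comm.
Qed.

Lemma limit_block_diag m n : I m -> I n -> m <> n -> Q m \o V \o Q n = 0.
Proof.
move=> Im In mn; apply/funext => x /=.
by rewrite block_JSigma //; case: eqP.
Qed.

Local Notation P' := (fun n => W \o Q n \o opinv W).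

(** Everything is transported by W from A - V, which is reduced by Q n. The
    spectrum of A - V is the union of the spectra of its parts in the range and in
    the kernel of Q n; that the latter is exactly the complement of the former is
    the disjointness of the two. *)
Lemma limit_spectral_projection n : I n ->
  spectral_projection (op_sub A B) (spectrum_on (op_sub A V) (range (Q n))) (P' n).
Proof.
move=> In; have sim := limit_similarity; have [iW domW TW] := sim.
have [bW' W1 W2] := opinvP iW; have red := limit_reduces In.
have lAV := linear_operator_sub lA bV.1.
have idem x : Q n (Q n x) = Q n x by rewrite comp_block // eqxx.
have eQ : range (Q n) = [set x | Q n x = x].
  by apply/seteqP; split=> [_ [x _ <-] /=|x /= <-]; [exact: idem|exists x].
have eP : range (P' n) = W @` range (Q n).
  apply/seteqP; split=> [_ [x _ <-] /=|_ [_ [x _ <-] <-]].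
    by exists (Q n (opinv W x)) => //; exists (opinv W x).
  by exists (W x) => //=; rewrite W2.
have eK : P' n @^-1` [set 0] = W @` [set x | Q n x = 0].
  apply/seteqP; split=> [x /= h|_ [x /= h <-] /=]; last first.
    by rewrite W2 h (lin0 bW.1).
  exists (opinv W x) => //; rewrite -(W2 (Q n _)).
  by have -> : W (Q n (opinv W x)) = 0 by []; rewrite (lin0 bW'.1).
have specT : spectrum (op_sub A B) = spectrum (op_sub A V).
  have WT : W @` setT = setT.
    by apply/seteqP; split=> // x _; exists (opinv W x).
  by have := spectrum_on_similarity setT sim; rewrite WT.
have redC : reduces (op_sub A V) (id - Q n).
  move=> x dx; have [dq eq] := red x dx.
  by have [d ->] := linear_operatorB lAV dx dq; split=> //; rewrite eq.
have kerE : [set x | Q n x = 0] = [set x | (id - Q n) x = x].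
  apply/seteqP; split=> x /=; rewrite !fctE.
    by move=> ->; rewrite subr0.
  by move=> /eqP; rewrite subr_eq -{1}(addr0 x) => /eqP/addrI <-.
split.
- split; last first.
    by apply/funext => x /=; rewrite W2 idem.
  by apply: bounded_op_comp bW'; apply: bounded_op_comp (bounded_block_proj n).
- rewrite -domW => _ [x dx <-]; have [dq eq] := red x dx.
  have -> : P' n (W x) = W (Q n x) by rewrite /= W2.
  split; first by exists (Q n x).
  transitivity (W (op_sub A V (Q n x))); first exact: TW.
  by rewrite eq (TW x dx) /comp W2.
- rewrite specT => z h [S hS]; apply: h; exists S.
  by rewrite eQ; apply: resolvent_restrict hS => //; exact: linear_block_proj.
- by rewrite eP; exact: spectrum_on_similarity.
rewrite eK (spectrum_on_similarity _ sim) specT; apply/seteqP; split=> z.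
  move=> h; split=> [[S hS]|].
    apply: h; exists S; rewrite kerE; apply: resolvent_restrict hS => //.
    by case: (bounded_opB (@bounded_op_id _ _) (bounded_block_proj n)).
  rewrite eQ => hr; have [] := limit_spectra_disjoint z In; last exact: h.
  exact: hr.
move=> [hT /contrapT[S1 hS1]] [S2 hS2]; apply: hT.
rewrite eQ in hS1; apply: (resolvent_combine lAV red (bounded_block_proj n) _ hS1 hS2).
by apply/funext => x /=.
Qed.

Lemma limit_resolution : resolution_of_identity
  (fun x y => inner (opinv W x) (opinv W y)) I P'.
Proof.
have iW := limit_transform_invertible; have [bW' W1 W2] := opinvP iW.
have rQ := resolution_block_proj.
split=> [n In|n In x y|m n Im In mn|x].
- split; first by apply: bounded_op_comp bW'; apply: bounded_op_comp (bounded_block_proj n).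
  by apply/funext => x /=; rewrite W2 (res_idem rQ).
- by rewrite /= !W2 (res_adj rQ).
- by apply/funext => x /=; rewrite W2 (res_orth rQ) // (lin0 bW.1).
by have := uncond_sum_lin bW (res_sum rQ (opinv W x)); rewrite W1.
Qed.

End Blocks.

(** * The gap constant eta *)

Section EtaGap.
Variables (R : realType) (lam : int -> R[i]).
Hypothesis eta_fin : (eta_gap lam < +oo)%E.

Let term n j : \bar R := ((rnorm (lam n - lam j) ^+ 2)%:E^-1)%E.

Let term_ge0 n j : (0 <= term n j)%E.
Proof. by rewrite inve_ge0 lee_fin sqr_ge0. Qed.

Let row_le j : (\esum_(n in [set n | n != j]) term n j <= eta_gap lam)%E.
Proof. by apply: ereal_sup_ubound; exists j. Qed.

Let row_finite j (F : {fset int}) : j \notin F ->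
  (\sum_(n <- F) term n j <= eta_gap lam)%E.
Proof.
move=> jF; apply: le_trans (row_le j); apply: esum_ge; exists [set` F].
  split; first exact: finite_fset.
  by move=> n /= nF; apply: contraNneq jF => <-.
by rewrite -fsbig_seq ?fset_uniq.
Qed.

(** The inverse of 0 is infinite, and eta is finite. *)
Lemma eta_gap_inj m n : lam m = lam n -> m = n.
Proof.
move=> mn; apply/eqP; apply: contraT => neq.
have := @row_finite n [fset m]%fset; rewrite big_seq_fset1 inE eq_sym => /(_ neq).
rewrite /term mn subrr rnorm0 expr0n /= inve0 leye_eq => /eqP E.
by move: eta_fin; rewrite E.
Qed.

Lemma eta_gap_fin : eta_gap lam = (fine (eta_gap lam))%:E.
Proof.
rewrite fineK // ge0_fin_numE //; apply: le_trans (row_le 0).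
by apply: esum_ge0 => n _; exact: term_ge0.
Qed.

Lemma eta_gapP j (F : {fset int}) : j \notin F ->
  \sum_(n <- F) (rnorm (lam n - lam j))^-1 ^+ 2 <= fine (eta_gap lam).
Proof.
move=> jF; rewrite -lee_fin -eta_gap_fin -sumEFin.
apply: le_trans (row_finite jF); rewrite le_eqVlt; apply/orP; left; apply/eqP.
apply: eq_big_seq => n nF; rewrite /term inver exprVn ifF //.
rewrite sqrf_eq0 rnorm_eq0 subr_eq0; apply/eqP => /eta_gap_inj nj.
by rewrite -nj nF in jF.
Qed.

Lemma eta_gap_gt0 : 0 < fine (eta_gap lam).
Proof.
have := @eta_gapP 0 [fset 1]%fset; rewrite big_seq_fset1 inE => /(_ isT).
apply: lt_le_trans; rewrite exprn_gt0 // invr_gt0 rnorm_gt0 subr_eq0.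
by apply/eqP => /eta_gap_inj.
Qed.

End EtaGap.

(** * The similarity theorem *)

Theorem theorem4p4 (R : realType) (H : completeNormedModType R[i])
    (inner : {dot H for Num.Def.conjC}) (A : operator H) (lam : int -> R[i])
    (I : set int) (sigma : int -> set R[i]) (B : H -> H) :
  let P := fun n => riesz_projection inner A (lam n) in
  let Psigma := block_proj P lam sigma in
  let S2 := S2 P lam I sigma in
  let J := JSigma P lam I sigma in
  let G := GammaSigma P lam I sigma in
  let X := fun k => iter k (Phi P lam I sigma B) 0 in
  norm_of_inner inner ->
  separable H ->
  linear_operator A ->
  dense (dom A) ->
  (* (A1) *)
  closed_operator A ->
  normal inner A ->
  (* (A2) *)
  spectrum A = range lam ->
  (forall n, semisimple_eigenvalue inner A (lam n) /\ finite_rank (P n)) ->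
  (* (A3) *)
  resolution_of_identity inner setT P ->
  (* (A4) *)
  (eta_gap lam < +oo)%E ->
  (* (A5) *)
  (forall e : R, 0 < e ->
    exists2 z, resolvent_set A z & opnorm (resolvent A z) < e) ->
  partition I sigma (spectrum A) ->
  S2 B ->
  J B = 0 ->
  (S2norm P lam I sigma B < ((3 * Num.sqrt (fine (eta_gap lam)))^-1)%:E)%E ->
  (exists Xs, S2_limit P lam I sigma X Xs) /\
  forall Xs, S2_limit P lam I sigma X Xs ->
    let U := G Xs in
    let V := J Xs in
    let W := id + U in
    let P' := fun n => W \o Psigma n \o opinv W in
    [/\ V = J (B \o U),
        [/\ S2 U, S2 V & similarity (op_sub A B) (op_sub A V) W],
        forall m n, I m -> I n -> m <> n -> Psigma m \o V \o Psigma n = 0,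
        (* the part of A - V in the range of Psigma n has the spectrum
           sigma'_n, the component of spectrum (A - B) corresponding to
           sigma n *)
        forall n, I n ->
          spectral_projection (op_sub A B)
            (spectrum_on (op_sub A V) (range (Psigma n))) (P' n) &
        (* W is not unitary in general: the P' n are orthogonal for the
           equivalent inner product transported by W *)
        resolution_of_identity
          (fun x y => inner (opinv W x) (opinv W y)) I P'].
Proof.
move=> P Psigma S2' J G X nin _ lA _ cA nA specA ss hP eta_fin hA5 part.
move=> [bB S2B] JB0 small.
set gam := Num.sqrt (fine (eta_gap lam)) in small.
have eta0 := eta_gap_gt0 eta_fin.
have gamp : 0 < gam by rewrite sqrtr_gt0.
have gam0 := ltW gamp.
have gapP j (F : {fset int}) : j \notin F ->
    \sum_(n <- F) (rnorm (lam n - lam j))^-1 ^+ 2 <= gam ^+ 2.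
  by rewrite sqr_sqrtr ?(ltW eta0) //; exact: eta_gapP.
have lam_inj := @eta_gap_inj _ _ eta_fin.
have [sig_cover sig_triv _] := part.
have blk_ex k : exists n, I n /\ sigma n (lam k).
  have : cover I sigma (lam k) by rewrite sig_cover specA; exists k.
  by move=> [n In sn]; exists n.
have [blk hblk] := choice blk_ex.
have blkI k : I (blk k) by case: (hblk k).
have blkP n k : I n -> sigma n (lam k) <-> blk k = n.
  move=> In; split=> [sn|<-]; last by case: (hblk k).
  by have [Ib sb] := hblk k; apply: sig_triv => //; exists (lam k).
have hPA n x : dom A (P n x) /\ A (P n x) = lam n *: P n x.
  by have [[_ _ h] _] := ss n; exact: h.
have B0 : (0 <= S2norm P lam I sigma B)%E by exact: poweR_ge0.
have Bfin : S2norm P lam I sigma B = (fine (S2norm P lam I sigma B))%:E.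
  by rewrite fineK // ge0_fin_numE.
set beta := fine _ in Bfin.
have beta0 : 0 <= beta by rewrite -lee_fin -Bfin.
have hB : S2_le P lam I sigma B beta by apply/S2normP => //; rewrite Bfin.
have {}small : 3 * beta * gam < 1.
  move: small; rewrite Bfin lte_fin -[_^-1]mul1r ltr_pdivlMr ?mulr_gt0 //.
  by rewrite mulrCA mulrA.
have conv := iterates_converge nin hP blkI blkP gam0 gapP hB gamp small.
split=> // Xs lim U V W P'.
have lim' := limit_fixed nin hP blkI blkP gam0 gapP hB gamp small lim.
have hU := S2_le_GammaSigma nin hP blkI blkP gam0 gapP lim'.1.
have hV := S2_le_JSigma nin hP blkI blkP lim'.1.
split.
- exact: (limit_diag nin hP blkI blkP gam0 gapP hB gamp small lim JB0).
- split; [exact: S2_le_S2 hU|exact: S2_le_S2 hV|].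
  exact: (limit_similarity nin hP blkI blkP gam0 gapP hB gamp small lA cA nA hPA
    lam_inj hA5 lim JB0).
- move=> m n Im In mn.
  exact: (limit_block_diag nin hP blkI blkP gam0 gapP hB gamp small lim Im In mn).
- move=> n In.
  exact: (limit_spectral_projection nin hP blkI blkP gam0 gapP hB gamp small lA
    cA nA hPA lam_inj hA5 lim JB0 In).
exact: (limit_resolution nin hP blkI blkP gam0 gapP hB gamp small lim).
Qed.
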